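(* Let $\theta,\gamma\in(0,1)$ satisfy $\theta<(3-\sqrt5)/2$ and $\gamma>(\sqrt5-1)/2$, and let $\{G_{\ell,\theta,\gamma}(\mathbf w_n)\}_{n\ge1}$ be an $(\ell,\theta,\gamma)$-strongly heterogeneous sequence of ensembles. Then there are constants $C,c>0$ and an integer $N_0>0$ such that, for all $n>N_0$, whenever $$c<\alpha\max_{1\le k\le n}w_k<C(\log n)^{\gamma},$$ with probability at least $1-n^{-1/2}-2n^{-1/5}$ the coupled equations $$\dot X=[V(t)-\alpha L\otimes H]X$$ on a graph of $G_{\ell,\theta,\gamma}(\mathbf w_n)$ admit an exponential dichotomy: there are positive constants $K$ and $\eta$ and a projector $P$ that commutes with the evolution operator $T$ of the coupled equations (i.e. $P(t)T(t,s)=T(t,s)P(s)$) such that, for all $t\ge s\ge0$, $$\|T(t,s)P(s)\|\le Ke^{-\eta(t-s)}\quad\text{and}\quad \|T^{-1}(t,s)(I-P)(t)\|\le Ke^{-\eta(t-s)}.$$ Moreover, in such a situation, $\operatorname{rank}P=d\times\ell(n)$ (the dimension of the stable subspace).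
   Context: **Random graphs.** For each $n$ let $\mathbf w_n=(w_1,\dots,w_n)$ (the $w_i=w_i(n)$ may depend on $n$) with $\max_k w_k=w_1\ge w_2\ge\dots\ge w_n>0$ and $(\max_{1\le k\le n}w_k)^2\le\sum_{k=1}^n w_k$. The ensemble (probability space) $G(\mathbf w_n)$ consists of random labelled undirected graphs on nodes $1,\dots,n$ in which an edge between $i$ and $j$ (loops $i=j$ allowed) is present independently with probability $p_{ij}=w_iw_j/\sum_k w_k$. $A=(A_{ij})$ is the symmetric $(0,1)$ adjacency matrix; the degree is $\kappa_i=\sum_j A_{ij}$, whose expected value is $w_i$. **Strong heterogeneity.** Let $\ell:\mathbb N\to\mathbb N$ be non-decreasing ($\ell(n)\ge1$) and $\theta,\gamma\in(0,1)$. A sequence of ensembles $\{G(\mathbf w_n)\}_{n\ge1}$ is $(\ell,\theta,\gamma)$-strongly heterogeneous, and then denoted $G_{\ell,\theta,\gamma}(\mathbf w_n)$, if, with constants independent of $n$: - there is $\Gamma_0>0$ with $\ell(n)<\Gamma_0(\max_{1\le k\le n}w_k)^\theta$; - there is $c_0\in(0,1/2]$ with $\liminf_{n\to\infty} w_{\ell(n)}/\max_{1\le k\le n}w_k=2c_0$; - there are $\Gamma_1,\Gamma_2>0$ and $\beta>0$ such that $\Gamma_1(\log n)^{1+\beta}<w_i<\Gamma_2(\max_{1\le k\le n}w_k)^{1-\gamma}$ for every $i\in\{\ell(n)+1,\dots,n\}$. **Equations.** Fix $d\ge1$, a (symmetric) positive-definite real $d\times d$ matrix $H$, and a sequence $(V_i)_{i\ge1}$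 of continuous bounded maps $t\in\mathbb R\mapsto V_i(t)\in\mathbb R^{d\times d}$ with $\max_{i\ge1}\|V_i\|<+\infty$, where $\|V_i\|=\sup_{t>0}\|V_i(t)\|$. The isolated equations $\dot x_i=V_i(t)x_i$, with evolution operators $T_i(t,s)$ (so $x_i(t)=T_i(t,s)x_i(s)$), are assumed unstable: there are constants $\eta_0,K_0>0$, common to all $i$, with $\|T_i^{-1}(t,s)\|\le K_0e^{-\eta_0(t-s)}$ for all $t>s$. Norms are Euclidean and induced operator norms; $T^{-1}(t,s)=(T(t,s))^{-1}$. For coupling strength $\alpha$, the coupled equations are $\dot x_i=V_i(t)x_i+\alpha\sum_{j=1}^nA_{ij}[H x_j-Hx_i]$, $i=1,\dots,n$; in block form with $X=\mathrm{col}(x_1,\dots,x_n)\in\mathbb R^{nd}$, $V(t)=\mathrm{diag}(V_1(t),\dots,V_n(t))$, $L_{ij}=\delta_{ij}\kappa_i-A_{ij}$ and $\otimes$ the Kronecker product, they read $\dot X=[V(t)-\alpha L\otimes H]X$. $T(t,s)$ is the evolution operator: $X(t)=T(t,s)X(s)$. The constants $c,C,N_0$ may depend on the sequence of ensembles, $H$, and $(V_i)$ (including $\eta_0,K_0$). **Exponential dichotomy** on $\mathbb R_+$: existence of a family of projectors $P(t)$ with $P(t)T(t,s)=T(t,s)P(s)$ for $t\ge s>0$ and constants $K,\eta>0$ with the two displayed bounds for $t\ge s\ge0$. $\operatorname{rank}P$ is the (constant) rank of $P(t)$. *)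

(* Defs.v *)
From mathcomp Require Export all_boot all_order all_algebra.
From mathcomp Require Export mxtens.
From mathcomp Require Export all_classical all_reals all_analysis.

Set Implicit Arguments.
Unset Strict Implicit.
Unset Printing Implicit Defensive.

Import Order.TTheory GRing.Theory Num.Theory.
Import numFieldNormedType.Exports.

Local Open Scope classical_set_scope.
Local Open Scope ring_scope.

(* Nodes and everything attached to them are numbered from 1: a weight vector
   (w_1, ..., w_n) is a map [u : nat -> R] of which only the values u 1, ..., u n
   matter, and the ordinal [i : 'I_n] stands for the node [i.+1]. *)

Section RandomGraphs.
Context {R : realType}.
Implicit Types (n : nat) (u : nat -> R) (w : nat -> nat -> R).

Definition wmax n u : R := \big[Num.max/0]_(1 <= k < n.+1) u k.

Definition wsum n u : R := \sum_(1 <= k < n.+1) u k.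

Record admissible_weights n u : Prop := AdmissibleWeights {
  weights_noninc : forall k, (1 <= k < n)%N -> u k.+1 <= u k;
  weights_gt0 : forall k, (1 <= k <= n)%N -> 0 < u k;
  weights_max_sqr : wmax n u ^+ 2 <= wsum n u }.

Definition edge_prob n u (i j : 'I_n) : R := u i.+1 * u j.+1 / wsum n u.

(* A graph (loops allowed) is its symmetric adjacency matrix; the product ranges
   over the unordered pairs {i, j}, each represented once by i <= j. *)
Definition graph_mass n u (A : 'M[bool]_n) : R :=
  \prod_(ij : 'I_n * 'I_n | (ij.1 <= ij.2)%N)
    (if A ij.1 ij.2 then edge_prob u ij.1 ij.2 else 1 - edge_prob u ij.1 ij.2).

Definition graph_prob n u (E : 'M[bool]_n -> Prop) : R :=
  \sum_(A : 'M[bool]_n | (A^T == A) && `[< E A >]) graph_mass u A.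

(* When n < ell n the value [w n (ell n)] is meaningless; the condition on [ell]
   leaves only finitely many such n, so the limit inferior is not affected. *)
Record strongly_heterogeneous (ell : nat -> nat) (theta gamma : R) w : Prop :=
  StronglyHeterogeneous {
  ell_ge1 : forall n, (1 <= ell n)%N;
  ell_nondecreasing : {homo ell : m n / (m <= n)%N};
  ensembles_admissible : forall n, (1 <= n)%N -> admissible_weights n (w n);
  few_hubs : exists Gamma0 : R, 0 < Gamma0 /\
    forall n, (1 <= n)%N -> (ell n)%:R < Gamma0 * wmax n (w n) `^ theta;
  large_hubs : exists c0 : R, 0 < c0 <= 1 / 2 /\
    limn_einf (fun n => (w n (ell n) / wmax n (w n))%:E) = (2 * c0)%:E;
  low_degree_nodes : exists Gamma1 Gamma2 beta : R,
    [/\ 0 < Gamma1, 0 < Gamma2, 0 < beta &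
     forall n i, (1 <= n)%N -> (ell n < i <= n)%N ->
       Gamma1 * ln (n%:R : R) `^ (1 + beta) < w n i
         < Gamma2 * wmax n (w n) `^ (1 - gamma)] }.

End RandomGraphs.

Section LinearEquations.
Context {R : realType} {m : nat}.
Implicit Types (M P : 'M[R]_m) (x : 'cV[R]_m) (B : R -> 'M[R]_m)
  (T : R -> R -> 'M[R]_m).

Definition enorm x : R := Num.sqrt (\sum_i x i 0 ^+ 2).

(* operator norm induced by the Euclidean norm; the library norm [`|M|] of a
   matrix is the maximum of its entries *)
Definition opnorm M : R := sup [set enorm (M *m x) | x in [set x | enorm x <= 1]].

Definition posdefmx M : Prop :=
  M^T = M /\ forall x, x != 0 -> 0 < (x^T *m M *m x) 0 0.

Definition solution B (x : R -> 'cV[R]_m) : Prop :=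
  forall t : R, is_derive t (1 : R) x (B t *m x t).

Record evolution_operator B T : Prop := EvolutionOperator {
  evolution_id : forall s, T s s = 1%:M;
  evolution_solution : forall s x0, solution B (fun t => T t s *m x0);
  evolution_unique :
    forall x : R -> 'cV[R]_m, solution B x -> forall t s, x t = T t s *m x s }.

Definition exp_dichotomy T (P : R -> 'M[R]_m) : Prop :=
  [/\ forall t, 0 <= t -> P t *m P t = P t,
      forall t s, 0 <= s -> s <= t -> P t *m T t s = T t s *m P s &
      exists K eta : R, [/\ 0 < K, 0 < eta &
        forall t s, 0 <= s -> s <= t ->
          opnorm (T t s *m P s) <= K * expR (- eta * (t - s)) /\
          opnorm (invmx (T t s) *m (1%:M - P t)) <= K * expR (- eta * (t - s))]].

End LinearEquations.

Section CoupledEquations.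
Context {R : realType} {d : nat}.
Implicit Types (H : 'M[R]_d) (V : nat -> R -> 'M[R]_d).

Definition supnorm (V1 : R -> 'M[R]_d) : \bar R :=
  ereal_sup [set (opnorm (V1 t))%:E | t in [set t | 0 < t]].

Record bounded_continuous_family V : Prop := BoundedContinuousFamily {
  family_continuous : forall i, (1 <= i)%N -> continuous (V i);
  family_bounded : forall i, (1 <= i)%N -> exists M, forall t, opnorm (V i t) <= M;
  family_unif_bounded :
    (ereal_sup [set supnorm (V i) | i in [set i | (1 <= i)%N]] < +oo)%E }.

Definition uniformly_unstable V : Prop :=
  exists T : nat -> R -> R -> 'M[R]_d,
    (forall i, (1 <= i)%N -> evolution_operator (V i) (T i)) /\
    exists eta0 K0 : R, [/\ 0 < eta0, 0 < K0 &
      forall i t s, (1 <= i)%N -> s < t ->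
        opnorm (invmx (T i t s)) <= K0 * expR (- eta0 * (t - s))].

Definition degree n (A : 'M[bool]_n) (i : 'I_n) : R := \sum_j (A i j)%:R.

Definition laplacian n (A : 'M[bool]_n) : 'M[R]_n :=
  \matrix_(i, j) ((i == j)%:R * degree A i - (A i j)%:R).

(* diag (V_1 t, ..., V_n t): [delta_mx i i *t M] has M as its i-th diagonal block
   of size d and vanishes elsewhere *)
Definition block_diag n V (t : R) : 'M[R]_(n * d) :=
  \sum_(i < n) (delta_mx i i *t V i.+1 t).

Definition coupled_equations n V H (alpha : R) (A : 'M[bool]_n) (t : R) :
    'M[R]_(n * d) :=
  block_diag n V t - alpha *: (laplacian A *t H).

End CoupledEquations.

(* Main.v *)
Require Import Defs.
From mathcomp Require Import ring lra.

Set Implicit Arguments.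
Unset Strict Implicit.
Unset Printing Implicit Defensive.

Import Order.TTheory GRing.Theory Num.Theory.
Import numFieldNormedType.Exports.

Local Open Scope classical_set_scope.
Local Open Scope ring_scope.

(** Why the dichotomy holds. The first [ell n] nodes (the hubs) have weights
    comparable to the maximum [wmax], all other nodes have much smaller weights.
    When [alpha * wmax] exceeds a constant, the Laplacian damps a hub, at the rate
    [alpha * degree * h] where [h] is a lower bound for the form of [H] on unit
    vectors, faster than its isolated equation can expand it. When
    [alpha * wmax < ln n `^ gamma], the coupling felt by any other node is at most
    of order [(ln n / wmax) `^ gamma], which tends to zero, and the uniform
    instability of its isolated equation persists. So the hubs should span the
    stable directions, which are [d * ell n] in number.

    Probability. A Chernoff bound ([chernoff]) and a union bound
    ([graph_prob_union]) show that, outside an event of probability at most [1 / n],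
    every hub has at least a quarter of its expected degree and every other node
    less than four times its own; all weights are at least [8 * ln n], which makes
    the exponential tails summable over the nodes. The asymptotic comparisons of
    the weights are collected in [near_regime].

    Dynamics. From here on the graph is fixed. The perturbation is treated by a
    single indefinite quadratic form: the Euclidean norm squared on the hubs,
    minus a Lyapunov function of the isolated equation on each other node
    ([unstable_node_form]). On a good graph this form decreases strictly along
    all solutions of the coupled equations ([coupled_lyapunov]): the edges are
    estimated by Young's inequality with weights that charge an edge between a
    hub and another node mostly to the latter ([sum_edges_young]), so
    that only the number of hubs and the degrees of the other nodes enter.

    A strictly decreasing indefinite form implies an exponential dichotomy
    ([lyapunov_dichotomy]). The solutions that start in the negative space make
    the form more and more negative, hence grow exponentially. For the stable
    space, one takes for every late time the solutions that end in the positive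
    space at that time; their initial values stay bounded, and a limit point
    gives a solution on which the form is nonnegative for ever. Such solutions
    decay exponentially and form a complement of the negative space at time zero,
    so the dimension is that of the positive space. Boundedness of the projectors
    follows from the opposite signs of the form on the two spaces.

    Evolution operators are built by Picard iteration on the whole line
    ([fundamental_matrix]), with primitives of continuous functions as the only
    input from integration theory. *)

(** * Primitives and mean value inequalities *)

(** The differentiation rules for functions given by their values, which is the
    shape that the derivatives of matrix entries take. *)
Lemma is_derive_const (R : realType) (c x : R) : is_derive x 1 (fun=> c) 0.
Proof. exact: is_derive_cst. Qed.

Lemma is_derive_add (R : realType) (f g : R -> R) (x df dg : R) :
  is_derive x 1 f df -> is_derive x 1 g dg ->
  is_derive x 1 (fun y => f y + g y) (df + dg).
Proof. exact: is_deriveD. Qed.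

Lemma is_derive_sub (R : realType) (f g : R -> R) (x df dg : R) :
  is_derive x 1 f df -> is_derive x 1 g dg ->
  is_derive x 1 (fun y => f y - g y) (df - dg).
Proof. exact: is_deriveB. Qed.

Lemma is_derive_opp (R : realType) (f : R -> R) (x df : R) :
  is_derive x 1 f df -> is_derive x 1 (fun y => - f y) (- df).
Proof. exact: is_deriveN. Qed.

Lemma is_derive_mul (R : realType) (f g : R -> R) (x df dg : R) :
  is_derive x 1 f df -> is_derive x 1 g dg ->
  is_derive x 1 (fun y => f y * g y) (df * g x + f x * dg).
Proof.
move=> fx gx; apply: is_derive_eq (is_deriveM fx gx) _.
by rewrite addrC mulrC.
Qed.

Lemma is_derive_scale (R : realType) (c : R) (f : R -> R) (x df : R) :
  is_derive x 1 f df -> is_derive x 1 (fun y => c * f y) (c * df).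
Proof. exact: is_deriveZ. Qed.

Lemma is_derive_bigsum (R : realType) (n : nat) (f : 'I_n -> R -> R) (x : R)
    (df : 'I_n -> R) :
  (forall i, is_derive x 1 (f i) (df i)) ->
  is_derive x 1 (fun y => \sum_i f i y) (\sum_i df i).
Proof.
move=> fx; have := is_derive_sum fx.
by rewrite (_ : \sum_(i < n) f i = fun y => \sum_i f i y)//;
  apply/funext => y; rewrite fct_sumE.
Qed.

Lemma is_derive_continuous (R : realType) (f : R -> R) (x df : R) :
  is_derive x 1 f df -> {for x, continuous f}.
Proof. by case=> + _ => /derivable1_diffP/differentiable_continuous. Qed.

Lemma nonincreasing_of_derive (R : realType) (f df : R -> R) (a b : R) :
  (forall x, a <= x <= b -> is_derive x 1 f (df x)) ->
  (forall x, a < x < b -> df x <= 0) -> a <= b -> f b <= f a.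
Proof.
move=> fdf df0 ab; rewrite -subr_le0.
have [->|/eqP anb] := eqVneq a b; first by rewrite subrr.
have altb : a < b by rewrite lt_neqAle ab andbT; apply/eqP.
have [||c] := @MVT R f df a b altb.
- by move=> x; rewrite in_itv/= => /andP[ax xb]; apply: fdf; rewrite !ltW.
- apply: derivable_within_continuous => x; rewrite in_itv/= => xab.
  by case: (fdf x xab).
rewrite in_itv/= => cab ->.
by rewrite mulr_le0_ge0 ?subr_ge0// df0.
Qed.

Lemma const_of_derive0 (R : realType) (f : R -> R) (a b : R) :
  (forall x, a <= x <= b -> is_derive x 1 f 0) -> a <= b -> f b = f a.
Proof.
move=> f0 ab; apply/eqP; rewrite eq_le.
rewrite (@nonincreasing_of_derive _ f (fun=> 0) a b)//=.
rewrite -[f a]opprK -[f b]opprK lerN2.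
apply: (@nonincreasing_of_derive _ (fun x => - f x) (fun=> 0)) => // x xab.
by rewrite -oppr0; apply: is_derive_opp; exact: f0.
Qed.

(** With [dg] of constant sign [g] is monotone, so comparing the absolute
    increments makes the order of [s] and [t] irrelevant; with [s = 0] this
    estimates a primitive on both half-lines at once. *)
Lemma norm_increment_le (R : realType) (f g df dg : R -> R) :
  (forall x : R, is_derive x 1 f (df x)) -> (forall x : R, is_derive x 1 g (dg x)) ->
  (forall x, `|df x| <= dg x) -> forall s t, `|f t - f s| <= `|g t - g s|.
Proof.
move=> fdf gdg dfg s t.
wlog st : s t / s <= t => [hw|].
  by have [/hw//|/ltW/hw] := leP s t; rewrite distrC (distrC (g s)).
have fg : f t - g t <= f s - g s.
  apply: (@nonincreasing_of_derive _ (fun x => f x - g x)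
    (fun x => df x - dg x)) => // x _.
  rewrite subr_le0; exact: le_trans (ler_norm _) (dfg x).
have fNg : - f t - g t <= - f s - g s.
  apply: (@nonincreasing_of_derive _ (fun x => - f x - g x)
    (fun x => - df x - dg x)) => // x _.
  rewrite subr_le0; apply: le_trans (dfg x); rewrite -normrN; exact: ler_norm.
apply: le_trans (ler_norm _); rewrite ler_norml; lra.
Qed.

Lemma continuous_on_primitive (R : realType) (f : R -> R) (a : R) :
  continuous f -> exists G : R -> R, forall x : R, a < x -> is_derive x 1 G (f x).
Proof.
move=> fc; exists (fun x => \int[lebesgue_measure]_(t in `[a, x]) f t)%R.
move=> x ax.
have xu : x < x + 1 by rewrite ltrDl.
have intf : lebesgue_measure.-integrable `[a, x + 1] (EFin \o f).
  apply: continuous_compact_integrable; first exact: segment_compact.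
  exact: continuous_subspaceT.
have [d1 d2] := continuous_FTC1_closed xu intf ax (fc x).
by apply: DeriveDef => //; rewrite -derive1E.
Qed.

(** The integral from [- n.+1] is a primitive to the right of that point only, so
    a primitive on the line is glued from these, normalised to vanish at [0]. *)
Lemma primitive_exists (R : realType) (f : R -> R) :
  continuous f -> exists F : R -> R, (forall x : R, is_derive x 1 F (f x)) /\ F 0 = 0.
Proof.
move=> fc.
have [G GP] := choice (fun n : nat => continuous_on_primitive (- n.+1%:R) fc).
pose F x := G (Num.truncn `|x|).+1 x - G (Num.truncn `|x|).+1 0.
have ltN (n : nat) (x : R) : (Num.truncn `|x| <= n)%N -> - n.+1%:R < x.
  move=> xn; rewrite ltrNl; apply: le_lt_trans (ler_norm _) _; rewrite normrN.
  by apply: lt_le_trans (truncnS_gt _) _; rewrite ler_nat ltnS.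
(* two of the local primitives differ by a constant where both are defined *)
have Geq (n k : nat) (x : R) : - n.+1%:R < x -> - k.+1%:R < x ->
    G n x - G n 0 = G k x - G k 0.
  move=> nx kx.
  have dG (y : R) : - n.+1%:R < y -> - k.+1%:R < y ->
      is_derive y 1 (fun z => G n z - G k z) 0.
    move=> ny ky; 
    by rewrite -(subrr (f y)); apply: is_derive_sub; apply: GP.
  have n0 : - n.+1%:R < 0 :> R by rewrite oppr_lt0.
  have k0 : - k.+1%:R < 0 :> R by rewrite oppr_lt0.
  suff : G n x - G k x = G n 0 - G k 0 by move=> h; lra.
  have [x0|x0] := leP 0 x.
    apply: (@const_of_derive0 _ (fun z => G n z - G k z) 0 x) => //.
    by move=> y /andP[y0 _]; apply: dG; lra.
  symmetry.
  apply: (@const_of_derive0 _ (fun z => G n z - G k z) x 0); last exact: ltW.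
  by move=> y /andP[xy _]; apply: dG; lra.
exists F; split; last by rewrite /F subrr.
move=> x; pose n := (Num.truncn `|x|).+1.
have nx : - n.+1%:R < x by apply: ltN; rewrite /n.
apply: (@near_eq_is_derive _ _ _ (fun y => G n y - G n 0)).
- near=> y; rewrite /F; apply: Geq.
    by near: y; exact: lt_nbhsr.
  exact: ltN.
- rewrite -[f x]subr0; apply: is_derive_sub; exact: GP.
Unshelve. all: by end_near. Qed.

(** * Derivatives of matrix-valued functions and geometric limits *)

Lemma is_derive_mxP (R : realType) (p q : nat) (M : R -> 'M[R]_(p, q)) (t : R)
    (D : 'M[R]_(p, q)) :
  is_derive t 1 M D <-> forall i j, is_derive t 1 (fun x => M x i j) (D i j).
Proof.
split=> [[dM <-] i j|dM].
  have /derivable_mxP dMij := dM.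
  by apply: DeriveDef; [exact: dMij|rewrite derive_mx// mxE].
have dMt : derivable M t 1.
  by apply/derivable_mxP => i j; case: (dM i j).
apply: DeriveDef => //; rewrite derive_mx//.
by apply/matrixP => i j; rewrite mxE; case: (dM i j).
Qed.

Lemma is_derive_mulmx (R : realType) (p q r : nat) (M : R -> 'M[R]_(p, q))
    (N : R -> 'M[R]_(q, r)) (t : R) D E :
  is_derive t 1 M D -> is_derive t 1 N E ->
  is_derive t 1 (fun x => M x *m N x) (D *m N t + M t *m E).
Proof.
move=> /is_derive_mxP dM /is_derive_mxP dN; apply/is_derive_mxP => i j.
rewrite (_ : (fun x => (M x *m N x) i j) =
             (fun x => \sum_k M x i k * N x k j)); last first.
  by apply/funext => x; rewrite mxE.
rewrite !mxE -big_split/=; apply: is_derive_bigsum => k.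
exact: is_derive_mul.
Qed.

Lemma is_derive_trmx (R : realType) (p q : nat) (M : R -> 'M[R]_(p, q)) (t : R) D :
  is_derive t 1 M D -> is_derive t 1 (fun x => (M x)^T) D^T.
Proof.
move=> /is_derive_mxP dM; apply/is_derive_mxP => i j.
rewrite (_ : (fun x => (M x)^T i j) = (fun x => M x j i)) ?mxE//.
by apply/funext => x; rewrite mxE.
Qed.

Lemma is_derive_mulmx_const (R : realType) (p q r : nat) (M : R -> 'M[R]_(p, q))
    (A : 'M[R]_(q, r)) (t : R) D :
  is_derive t 1 M D -> is_derive t 1 (fun x => M x *m A) (D *m A).
Proof.
move=> dM; have := is_derive_mulmx dM (is_derive_cst A t 1).
by rewrite mulmx0 addr0.
Qed.

(** A sequence with steps at most [e / 2 ^ k.+1]: the bounds [u k - e / 2 ^ k]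
    increase and stay below the decreasing [u k + e / 2 ^ k], so their supremum
    is the limit. *)
Lemma geometric_limit (R : realType) (u : nat -> R) (e : R) :
  (forall k, `|u k.+1 - u k| <= e / 2 ^+ k.+1) ->
  exists l, forall k, `|l - u k| <= e / 2 ^+ k.
Proof.
move=> ue.
have half k : e / 2 ^+ k = e / 2 ^+ k.+1 + e / 2 ^+ k.+1 by rewrite exprS; field.
have step k : u k.+1 + e / 2 ^+ k.+1 <= u k + e / 2 ^+ k /\
    u k - e / 2 ^+ k <= u k.+1 - e / 2 ^+ k.+1.
  have := ue k; rewrite ler_norml [e / 2 ^+ k]half => /andP[h1 h2]; split; lra.
have dec j k : u (j + k)%N + e / 2 ^+ (j + k) <= u j + e / 2 ^+ j.
  elim: k => [|k IH]; first by rewrite addn0.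
  by rewrite addnS; apply: le_trans IH; case: (step (j + k)%N).
have inc j k : u j - e / 2 ^+ j <= u (j + k)%N - e / 2 ^+ (j + k).
  elim: k => [|k IH]; first by rewrite addn0.
  by rewrite addnS; apply: le_trans IH _; case: (step (j + k)%N).
have e0 k : 0 <= e / 2 ^+ k.
  by rewrite half; have := le_trans (normr_ge0 _) (ue k) => h; lra.
have lowup j k : u j - e / 2 ^+ j <= u k + e / 2 ^+ k.
  have := inc j k; have := dec k j; rewrite addnC.
  by have := e0 (j + k)%N => h1 h2 h3; lra.
pose S := [set u k - e / 2 ^+ k | k in [set: nat]].
have S0 : S !=set0 by exists (u 0%N - e / 2 ^+ 0); exists 0%N.
have Sub k : ubound S (u k + e / 2 ^+ k) by move=> _ [j _ <-]; exact: lowup.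
exists (sup S) => k.
have h1 : sup S <= u k + e / 2 ^+ k by apply: ge_sup.
have h2 : u k - e / 2 ^+ k <= sup S.
  by apply: ub_le_sup; [exists (u 0%N + e / 2 ^+ 0)|exists k].
by rewrite ler_norml; lra.
Qed.

(** How estimates that hold up to the error of the [k]-th iterate pass to the
    limit. *)
Lemma ler_geometric (R : realType) (x y e : R) : 0 <= e ->
  (forall k, x <= y + e / 2 ^+ k) -> x <= y.
Proof.
move=> e0 xe; apply/ler_addgt0Pr => d d0.
pose k := Num.truncn (e / d); apply: le_trans (xe k) _; rewrite lerD2l.
rewrite ler_pdivrMr ?exprn_gt0// mulrC -ler_pdivrMr//.
apply: le_trans (ltW (truncnS_gt _)) _; rewrite -/k -natrX ler_nat.
exact: ltn_expl.
Qed.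

(** * Existence of fundamental matrices *)

Lemma continuous_bigsum (R : realType) (n : nat) (f : 'I_n -> R -> R) :
  (forall i, continuous (f i)) -> continuous (fun t => \sum_i f i t).
Proof. by move=> fc; apply: continuous_big => // x; exact: add_continuous. Qed.

Lemma continuous_mulmx_entry (R : realType) (p q r : nat) (M : R -> 'M[R]_(p, q))
    (N : R -> 'M[R]_(q, r)) :
  (forall i j, continuous (fun t => M t i j)) ->
  (forall i j, continuous (fun t => N t i j)) ->
  forall i j, continuous (fun t => (M t *m N t) i j).
Proof.
move=> cM cN i j; rewrite (_ : (fun t => _) =
    (fun t => \sum_k M t i k * N t k j)); last by apply/funext => t; rewrite mxE.
by apply: continuous_bigsum => k t; apply: continuousM; [exact: cM|exact: cN].
Qed.

(** Picard iteration. As the coefficients are bounded, it converges on the whole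
    line: for the norm weighted by [E t = 2 cosh (2 K t)], where [K] bounds the
    multiplication by [B t], one step of the iteration is a contraction of ratio [1 / 2],
    because [2 K E] is the derivative of [S] and [`|S| <= E]. *)
Lemma fundamental_matrix (R : realType) (m : nat) (B : R -> 'M[R]_m) (b : R) :
  (forall i j, continuous (fun t => B t i j)) ->
  (forall t i j, `|B t i j| <= b) ->
  exists Phi : R -> 'M[R]_m,
    (forall t : R, is_derive t 1 Phi (B t *m Phi t)) /\ Phi 0 = 1%:M.
Proof.
move=> Bc Bb; pose K := m%:R * `|b| + 1.
have K0 : 0 < K by rewrite /K ltr_pwDr// mulr_ge0.
pose k2 := 2 * K.
have exp_d (c t : R) : is_derive t 1 (fun s => expR (c * s)) (c * expR (c * t)).
  have := is_derive1_comp (is_derive_expR (c * t)) (is_derive_scale c (is_derive_id t 1)).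
  by rewrite mulr1 mulrC.
pose E t := expR (k2 * t) + expR (- k2 * t).
pose S t := expR (k2 * t) - expR (- k2 * t).
have S_d (t : R) : is_derive t 1 S (k2 * E t).
  rewrite (_ : k2 * E t = k2 * expR (k2 * t) - - k2 * expR (- k2 * t)).
    by apply: is_derive_sub; exact: exp_d.
  by rewrite /E; ring.
have E1 t : 1 <= E t.
  have [t0|t0] := leP 0 t.
    rewrite -[1]addr0 /E lerD ?expR_ge0//.
    by rewrite -[1]expR0 ler_expR !mulr_ge0// ltW.
  rewrite -[1]add0r /E lerD ?expR_ge0//.
  by rewrite -[1]expR0 ler_expR mulNr -mulrN !mulr_ge0// ?ltW// oppr_gt0.
have E0 t : 0 <= E t by exact: le_trans ler01 (E1 t).
have S00 : S 0 = 0 by rewrite /S !mulr0 subrr.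
have SE t : `|S t| <= E t.
  by rewrite /S /E ler_norml; have := expR_ge0 (k2 * t);
    have := expR_ge0 (- k2 * t) => ? ?; lra.
have BX (X : 'M[R]_m) c t i j : (forall i j, `|X i j| <= c) -> 0 <= c ->
    `|(B t *m X) i j| <= K * c.
  move=> Xc c0; rewrite mxE; apply: le_trans (ler_norm_sum _ _ _) _.
  apply: (@le_trans _ _ (\sum_(k < m) `|b| * c)).
    apply: ler_sum => k _; rewrite normrM ler_pM//.
    by apply: le_trans (Bb _ _ _) _; exact: ler_norm.
  by rewrite sumr_const card_ord -mulr_natl /K mulrDl mulrA lerDl mul1r.
have prim (f : R -> R) : exists F : R -> R,
    continuous f -> (forall x : R, is_derive x 1 F (f x)) /\ F 0 = 0.
  have [/primitive_exists[F HF]|nf] := pselect (continuous f); first by exists F.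
  by exists f.
have {prim}[P HP] := choice prim.
pose Xc (X : R -> 'M[R]_m) := forall i j, continuous (fun t => X t i j).
pose step (X : R -> 'M[R]_m) t : 'M[R]_m :=
  1%:M + \matrix_(i, j) P (fun s => (B s *m X s) i j) t.
have step_d X i j (t : R) : Xc X ->
    is_derive t 1 (fun s => step X s i j) ((B t *m X t) i j).
  move=> cX; have /HP[dP _] := continuous_mulmx_entry Bc cX (i:=i) (j:=j).
  rewrite -[_ i j]add0r.
  rewrite (_ : (fun s => _) = (fun s => (i == j)%:R +
     P (fun s => (B s *m X s) i j) s)); last by apply/funext => s; rewrite !mxE.
  by apply: is_derive_add; exact: dP.
have step0 X : Xc X -> step X 0 = 1%:M.
  move=> cX; apply/matrixP => i j; rewrite !mxE.
  by have /HP[_ ->] := continuous_mulmx_entry Bc cX (i:=i) (j:=j); rewrite addr0.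
have step_c X : Xc X -> Xc (step X).
  by move=> cX i j t; exact: is_derive_continuous (step_d X i j t cX).
have step_contr X Y c : Xc X -> Xc Y -> 0 <= c ->
    (forall t i j, `|X t i j - Y t i j| <= c * E t) ->
    forall t i j, `|step X t i j - step Y t i j| <= c / 2 * E t.
  move=> cX cY c0 XY t i j.
  have := @norm_increment_le R (fun t => step X t i j - step Y t i j)
    (fun t => c / 2 * S t) (fun t => (B t *m X t) i j - (B t *m Y t) i j)
    (fun t => c / 2 * (k2 * E t)).
  move=> /(_ _ _ _ 0 t); rewrite !step0// subrr !subr0 S00 mulr0 subr0.
  move=> /(_ (fun t => is_derive_sub (step_d X i j t cX) (step_d Y i j t cY))).
  have d t' : `|(B t' *m X t') i j - (B t' *m Y t') i j| <= c / 2 * (k2 * E t').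
    have -> : (B t' *m X t') i j - (B t' *m Y t') i j = (B t' *m (X t' - Y t')) i j.
      by rewrite mulmxBr !mxE.
    have -> : c / 2 * (k2 * E t') = K * (c * E t') by rewrite /k2; field.
    by apply: BX => [i' j'|]; rewrite ?mulr_ge0// !mxE; exact: XY.
  move=> /(_ d) h; apply: le_trans h _.
  by rewrite normrM ger0_norm ?divr_ge0// ler_wpM2l// divr_ge0.
pose X_ k := iter k step (fun=> 1%:M).
have X_c k : Xc (X_ k).
  by elim: k => [i j|k IH]; [exact: cst_continuous|exact: step_c].
have X_step k t i j : `|X_ k.+1 t i j - X_ k t i j| <= E t / 2 ^+ k.+1.
  suff : forall t i j, `|X_ k.+1 t i j - X_ k t i j| <= (1 / 2 ^+ k.+1) * E t.
    by move=> /(_ t i j); rewrite mul1r mulrC.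
  elim: k => [|k IH] {}t {}i {}j.
    have -> : X_ 1%N t i j - X_ 0%N t i j =
        step (X_ 0%N) t i j - step (fun=> 0) t i j.
      rewrite [step (fun=> 0) t i j]mxE [X in _ - (_ + X)]mxE.
      rewrite (_ : (fun s => _) = (fun=> 0)); last first.
        by apply/funext => s; rewrite mulmx0 mxE.
      have [] := HP (fun=> 0) (@cst_continuous _ _ 0) => d0 P0.
      rewrite (_ : P (fun=> 0) t = 0) ?addr0//.
      by rewrite -[RHS]P0; exact: is_derive_0_is_cst (P (fun=> 0)) _ _ d0.
    apply: step_contr => //; first by move=> i' j'; exact: cst_continuous.
    move=> t' i' j'; rewrite !mxE subr0 mul1r.
    by apply: le_trans (E1 t'); case: eqP; rewrite ?normr1 ?normr0.
  have -> : 1 / 2 ^+ k.+2 = 1 / 2 ^+ k.+1 / 2 :> R.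
    by rewrite [in LHS]exprS; field.
  by apply: (step_contr (X_ k.+1) (X_ k)) => //; rewrite divr_ge0// exprn_ge0.
have [Phi PhiP] : exists Phi : R -> 'M[R]_m,
    forall t i j k, `|Phi t i j - X_ k t i j| <= E t / 2 ^+ k.
  have lim (tij : R * 'I_m * 'I_m) :=
    geometric_limit (fun k => X_step k tij.1.1 tij.1.2 tij.2).
  have [L HL] := choice lim.
  exists (fun t => \matrix_(i, j) L (t, i, j)) => t i j k.
  by rewrite mxE; exact: HL (t, i, j) k.
(* every iterate is bounded by [3 * E], hence they are equicontinuous *)
have X_3 k t i j : `|X_ k t i j| <= 3 * E t.
  have h0 := PhiP t i j 0%N; rewrite expr0 divr1 in h0.
  have hk : `|Phi t i j - X_ k t i j| <= E t.
    apply: le_trans (PhiP t i j k) _; rewrite ler_pdivrMr ?exprn_gt0//.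
    by rewrite ler_peMr// -natrX ler1n expn_gt0.
  have h1 : `|X_ 0%N t i j| <= E t.
    rewrite mxE; apply: le_trans (E1 t).
    by case: eqP; rewrite ?normr1 ?normr0.
  move: h0 hk h1; rewrite !ler_norml => /andP[? ?] /andP[? ?] /andP[? ?]; lra.
have X_lip k t s i j : `|X_ k.+1 t i j - X_ k.+1 s i j| <= `|3/2 * S t - 3/2 * S s|.
  apply: (@norm_increment_le R (fun t => X_ k.+1 t i j) (fun t => 3/2 * S t)
    (fun t => (B t *m X_ k t) i j) (fun t => 3/2 * (k2 * E t))).
  - by move=> t'; exact: step_d.
  - move=> t'; have -> : 3 / 2 * (k2 * E t') = K * (3 * E t') by rewrite /k2; field.
    by apply: BX => //; rewrite mulr_ge0.
have Phi_lip t s i j : `|Phi t i j - Phi s i j| <= `|3/2 * S t - 3/2 * S s|.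
  apply: (@ler_geometric _ _ _ (E t + E s)); first by rewrite addr_ge0.
  move=> k; have := X_lip k t s i j; set c := `|3/2 * _ - _|.
  have h t' : `|Phi t' i j - X_ k.+1 t' i j| <= E t' / 2 ^+ k.
    apply: le_trans (PhiP _ _ _ _) _; rewrite ler_pM2l ?(lt_le_trans ltr01)//.
    by rewrite lef_pV2 ?posrE ?exprn_gt0// ler_eXn2l ?ltr1n.
  have -> : (E t + E s) / 2 ^+ k = E t / 2 ^+ k + E s / 2 ^+ k by exact: mulrDl.
  move: (h t) (h s); rewrite !ler_norml => /andP[? ?] /andP[? ?] /andP[? ?].
  by apply/andP; split; lra.
have Phi_c : Xc Phi.
  move=> i j t; apply/cvgrPdist_le => e e0.
  have : {for t, continuous (fun s => 3/2 * S s)}.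
    by apply: is_derive_continuous (is_derive_scale (3/2) (S_d t)).
  move=> /cvgrPdist_le /(_ e e0); apply: filterS => s.
  by apply: le_trans; exact: Phi_lip.
have fixed : step Phi = Phi.
  apply/funext => t; apply/matrixP => i j; apply/eqP; rewrite -subr_eq0.
  rewrite -normr_le0; apply: (@ler_geometric _ _ _ (E t)) => // k.
  rewrite add0r.
  have h1 := step_contr Phi (X_ k.+1) (1 / 2 ^+ k.+1) Phi_c (X_c _) _ _ t i j.
  have h2 := PhiP t i j k.+2.
  have : `|step Phi t i j - step (X_ k.+1) t i j| <= 1 / 2 ^+ k.+1 / 2 * E t.
    apply: h1 => [|t' i' j']; first by rewrite divr_ge0// exprn_ge0.
    by rewrite mul1r mulrC; exact: PhiP.
  rewrite -[step (X_ k.+1) t i j]/(X_ k.+2 t i j).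
  have -> : 1 / 2 ^+ k.+1 / 2 * E t = E t / 2 ^+ k / 4 by rewrite exprS; field.
  have e4 : E t / 2 ^+ k.+2 = E t / 2 ^+ k / 4 by rewrite !exprS; field.
  have : 0 <= E t / 2 ^+ k by rewrite divr_ge0// exprn_ge0.
  move: h2; rewrite e4 !ler_norml => /andP[? ?] ? /andP[? ?].
  by apply/andP; split; lra.
exists Phi; split; last by rewrite -fixed step0.
by move=> t; rewrite -{1}fixed; apply/is_derive_mxP => i j; exact: step_d.
Qed.

(** * Euclidean inner product and operator norm *)

Definition dot (R : realType) (m : nat) (x y : 'cV[R]_m) : R := (x^T *m y) 0 0.

Lemma dotE (R : realType) (m : nat) (x y : 'cV[R]_m) :
  dot x y = \sum_i x i 0 * y i 0.
Proof. by rewrite /dot mxE; apply: eq_bigr => i _; rewrite mxE. Qed.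

Lemma dotC (R : realType) (m : nat) (x y : 'cV[R]_m) : dot x y = dot y x.
Proof. by rewrite !dotE; apply: eq_bigr => i _; rewrite mulrC. Qed.

Lemma dotDl (R : realType) (m : nat) (x y z : 'cV[R]_m) :
  dot (x + y) z = dot x z + dot y z.
Proof. by rewrite /dot linearD/= mulmxDl mxE. Qed.

Lemma dotDr (R : realType) (m : nat) (x y z : 'cV[R]_m) :
  dot z (x + y) = dot z x + dot z y.
Proof. by rewrite /dot mulmxDr mxE. Qed.

Lemma dotZl (R : realType) (m : nat) a (x y : 'cV[R]_m) :
  dot (a *: x) y = a * dot x y.
Proof. by rewrite /dot linearZ/= -scalemxAl mxE. Qed.

Lemma dotZr (R : realType) (m : nat) a (x y : 'cV[R]_m) :
  dot x (a *: y) = a * dot x y.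
Proof. by rewrite dotC dotZl dotC. Qed.

Lemma dotNl (R : realType) (m : nat) (x y : 'cV[R]_m) : dot (- x) y = - dot x y.
Proof. by rewrite -scaleN1r dotZl mulN1r. Qed.

Lemma dotNr (R : realType) (m : nat) (x y : 'cV[R]_m) : dot x (- y) = - dot x y.
Proof. by rewrite dotC dotNl dotC. Qed.

Lemma dot0r (R : realType) (m : nat) (x : 'cV[R]_m) : dot x 0 = 0.
Proof. by rewrite /dot mulmx0 mxE. Qed.

Lemma dot_mull (R : realType) (m p : nat) (A : 'M[R]_(m, p)) x y :
  dot (A *m x) y = dot x (A^T *m y).
Proof. by rewrite /dot trmx_mul mulmxA. Qed.

Lemma dot_sumr (R : realType) (m n : nat) (x : 'cV[R]_m) (y : 'I_n -> 'cV[R]_m) :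
  dot x (\sum_i y i) = \sum_i dot x (y i).
Proof.
by elim/big_ind2: _ => [|a ? b ? <- <-|//]; rewrite ?dot0r ?dotDr.
Qed.

Lemma dot_ge0 (R : realType) (m : nat) (x : 'cV[R]_m) : 0 <= dot x x.
Proof. by rewrite dotE sumr_ge0// => i _; rewrite -expr2 sqr_ge0. Qed.

Lemma dot_eq0 (R : realType) (m : nat) (x : 'cV[R]_m) : (dot x x == 0) = (x == 0).
Proof.
apply/idP/eqP => [|->]; last by rewrite dot0r.
rewrite dotE psumr_eq0; last by move=> i _; rewrite -expr2 sqr_ge0.
move=> /allP x0; apply/colP => i; apply/eqP; rewrite mxE -sqrf_eq0 expr2.
by apply: (implyP (x0 i _)); rewrite ?mem_index_enum.
Qed.

Lemma enorm_sqr (R : realType) (m : nat) (x : 'cV[R]_m) : enorm x ^+ 2 = dot x x.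
Proof.
rewrite sqr_sqrtr; last by rewrite sumr_ge0// => i _; rewrite sqr_ge0.
by rewrite dotE; apply: eq_bigr => i _; rewrite expr2.
Qed.

Lemma enorm_ge0 (R : realType) (m : nat) (x : 'cV[R]_m) : 0 <= enorm x.
Proof. exact: sqrtr_ge0. Qed.

Lemma enorm_eq0 (R : realType) (m : nat) (x : 'cV[R]_m) : (enorm x == 0) = (x == 0).
Proof. by rewrite -dot_eq0 -enorm_sqr sqrf_eq0. Qed.

Lemma enormE (R : realType) (m : nat) (x : 'cV[R]_m) : enorm x = Num.sqrt (dot x x).
Proof. by rewrite -enorm_sqr sqrtr_sqr ger0_norm ?enorm_ge0. Qed.

Lemma enorm_le (R : realType) (m p : nat) (x : 'cV[R]_m) (y : 'cV[R]_p) c :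
  0 <= c -> dot x x <= c ^+ 2 * dot y y -> enorm x <= c * enorm y.
Proof.
move=> c0; rewrite -!enorm_sqr -exprMn ler_sqr// nnegrE ?mulr_ge0 ?enorm_ge0//.
Qed.

Lemma cauchy_schwarz (R : realType) (m : nat) (x y : 'cV[R]_m) :
  `|dot x y| <= enorm x * enorm y.
Proof.
have half (z t : 'cV[R]_m) : dot z t <= enorm z * enorm t.
  have [/eqP|z0] := eqVneq (enorm z) 0.
    by rewrite enorm_eq0 => /eqP ->; rewrite dotC dot0r mulr_ge0 ?enorm_ge0.
  have [/eqP|t0] := eqVneq (enorm t) 0.
    by rewrite enorm_eq0 => /eqP ->; rewrite dot0r mulr_ge0 ?enorm_ge0.
  have zt : 0 < enorm z * enorm t.
    by rewrite mulr_gt0// lt_neqAle enorm_ge0 eq_sym ?z0 ?t0.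
  have := dot_ge0 (enorm t *: z - enorm z *: t).
  rewrite !(dotDl, dotDr, dotNl, dotNr, dotZl, dotZr) -!enorm_sqr (dotC t z).
  set p := enorm z in zt *; set q := enorm t in zt *; set s := dot z t.
  move=> h; rewrite -(ler_pM2l zt); lra.
rewrite ler_norml half andbT lerNl -dotNl.
by apply: le_trans (half _ _) _; rewrite !enormE dotNl dotNr opprK.
Qed.

Lemma enorm0 (R : realType) (m : nat) : enorm (0 : 'cV[R]_m) = 0.
Proof. by apply/eqP; rewrite enorm_eq0. Qed.

Lemma enormZ (R : realType) (m : nat) a (x : 'cV[R]_m) : enorm (a *: x) = `|a| * enorm x.
Proof.
by rewrite !enormE dotZl dotZr mulrA -expr2 sqrtrM ?sqr_ge0// sqrtr_sqr.
Qed.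

Lemma entry_le_enorm (R : realType) (m : nat) (x : 'cV[R]_m) i : `|x i 0| <= enorm x.
Proof.
rewrite enormE -sqrtr_sqr ler_sqrt ?dot_ge0// dotE (bigD1 i)//= -expr2 lerDl.
by rewrite sumr_ge0// => j _; rewrite -expr2 sqr_ge0.
Qed.

Lemma enorm_mulmx_entries (R : realType) (m : nat) (A : 'M[R]_m) (b : R) x :
  (forall i j, `|A i j| <= b) -> enorm (A *m x) <= (m%:R * b) * enorm x.
Proof.
move=> Ab; case: m A x Ab => [|m] A x Ab.
  by rewrite (_ : A *m x = 0) ?enorm0 ?mul0r//; apply/colP => -[].
have b0 : 0 <= b by apply: le_trans (Ab 0 0).
apply: enorm_le; first by rewrite mulr_ge0.
rewrite dotE; apply: (@le_trans _ _ (\sum_(i < m.+1) m.+1%:R * b ^+ 2 * dot x x)).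
  apply: ler_sum => i _; pose r : 'cV[R]_m.+1 := \col_j A i j.
  have -> : (A *m x) i 0 = dot r x.
    by rewrite dotE mxE; apply: eq_bigr => j _; rewrite mxE.
  rewrite -expr2 -real_normK ?num_real//.
  apply: (@le_trans _ _ ((enorm r * enorm x) ^+ 2)).
    by rewrite ler_sqr ?nnegrE ?mulr_ge0 ?enorm_ge0//; exact: cauchy_schwarz.
  rewrite exprMn !enorm_sqr ler_wpM2r ?dot_ge0// dotE.
  apply: (@le_trans _ _ (\sum_(j < m.+1) b ^+ 2)); last first.
    by rewrite sumr_const card_ord -[leLHS]mulr_natl.
  apply: ler_sum => j _; rewrite mxE -expr2 -real_normK ?num_real//.
  by rewrite ler_sqr ?nnegrE.
rewrite sumr_const card_ord -[leLHS]mulr_natl !mulrA exprMn.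
by rewrite -!mulrA lexx.
Qed.

Lemma opnorm_le (R : realType) (m : nat) (A : 'M[R]_m) (c : R) :
  (forall x, enorm (A *m x) <= c * enorm x) -> 0 <= c -> opnorm A <= c.
Proof.
move=> Ac c0; apply: ge_sup.
  by exists (enorm (A *m 0)); exists 0 => //=; rewrite enorm0.
move=> _ [x /= x1 <-]; apply: le_trans (Ac x) _.
by rewrite -[leRHS]mulr1 ler_wpM2l.
Qed.

Lemma mx_entries_bounded (R : realType) (m p : nat) (A : 'M[R]_(m, p)) :
  exists2 b, 0 <= b & forall i j, `|A i j| <= b.
Proof.
exists (\sum_i \sum_j `|A i j|).
  by rewrite sumr_ge0// => i _; rewrite sumr_ge0.
move=> i j; rewrite (bigD1 i)//= (bigD1 j)//= -addrA lerDl addr_ge0//.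
  by rewrite sumr_ge0.
by rewrite sumr_ge0// => k _; rewrite sumr_ge0.
Qed.

(** [opnorm] is a supremum of reals, so it bounds anything only because the set
    is bounded above, which the crude bound by the entries provides. *)
Lemma enorm_mulmx_le (R : realType) (m : nat) (A : 'M[R]_m) x :
  enorm (A *m x) <= opnorm A * enorm x.
Proof.
have [/eqP|x0] := eqVneq (enorm x) 0.
  by rewrite enorm_eq0 => /eqP ->; rewrite mulmx0 enorm0 mulr0.
have xgt0 : 0 < enorm x by rewrite lt_neqAle enorm_ge0 eq_sym x0.
have [b b0 Ab] := mx_entries_bounded A.
rewrite -ler_pdivrMr// mulrC -[X in X * _]ger0_norm ?invr_ge0 ?enorm_ge0//.
rewrite -enormZ scalemxAr; apply: ub_le_sup.
  exists (m%:R * b) => _ [y /= y1 <-].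
  apply: le_trans (enorm_mulmx_entries _ Ab) _.
  by rewrite -[leRHS]mulr1 ler_wpM2l// mulr_ge0.
exists ((enorm x)^-1 *: x) => //=.
by rewrite enormZ ger0_norm ?invr_ge0 ?enorm_ge0// mulVf.
Qed.

Lemma entry_le_opnorm (R : realType) (m : nat) (A : 'M[R]_m) i j :
  `|A i j| <= opnorm A.
Proof.
have -> : A i j = (A *m (delta_mx j 0 : 'cV_m)) i 0.
  by rewrite -colE mxE.
apply: le_trans (entry_le_enorm _ _) _; apply: le_trans (enorm_mulmx_le _ _) _.
rewrite (_ : enorm _ = 1) ?mulr1//.
rewrite enormE dotE (bigD1 j)//= big1 ?addr0; last first.
  by move=> k kj; rewrite mxE (negbTE kj) mul0r.
by rewrite !mxE !eqxx mulr1 sqrtr1.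
Qed.

Lemma is_derive_dot (R : realType) (m : nat) (x y : R -> 'cV[R]_m) (t : R) dx dy :
  is_derive t 1 x dx -> is_derive t 1 y dy ->
  is_derive t 1 (fun s => dot (x s) (y s)) (dot dx (y t) + dot (x t) dy).
Proof.
move=> xd yd; have := is_derive_mulmx (is_derive_trmx xd) yd.
by move=> /is_derive_mxP/(_ 0 0); rewrite mxE.
Qed.

(** * Evolution operators *)

(** [Phi] is the fundamental matrix with [Phi 0 = 1] and [Psi] its inverse, so the
    evolution operator from [s] to [t] is [Phi t *m Psi s]. *)
Record fundamental_pair (R : realType) (m : nat) (B Phi Psi : R -> 'M[R]_m) : Prop :=
  FundamentalPair {
  fund_derive : forall t : R, is_derive t 1 Phi (B t *m Phi t);
  fund_inv_derive : forall t : R, is_derive t 1 Psi (- (Psi t *m B t));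
  fund0 : Phi 0 = 1%:M;
  fund_inv0 : Psi 0 = 1%:M;
  fundK : forall t, Psi t *m Phi t = 1%:M }.

Lemma is_derive_mx_const (R : realType) (p q : nat) (M : R -> 'M[R]_(p, q)) :
  (forall t : R, is_derive t 1 M 0) -> forall s t, M s = M t.
Proof.
move=> M0 s t; apply/matrixP => i j.
apply: (@is_derive_0_is_cst _ (fun x => M x i j)) => x.
by have /is_derive_mxP/(_ i j) := M0 x; rewrite mxE.
Qed.

(** The inverse of a fundamental matrix solves the adjoint equation, so it can be
    constructed as a transposed fundamental matrix without ever differentiating
    an inverse. *)
Lemma fundamental_pair_exists (R : realType) (m : nat) (B : R -> 'M[R]_m) (b : R) :
  (forall i j, continuous (fun t => B t i j)) ->
  (forall t i j, `|B t i j| <= b) ->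
  exists Phi Psi, fundamental_pair B Phi Psi.
Proof.
move=> Bc Bb; have [Phi [dPhi Phi0]] := fundamental_matrix Bc Bb.
have [|t i j|Th [dTh Th0]] := @fundamental_matrix R m (fun t => - (B t)^T) b.
- move=> i j t.
  rewrite (_ : (fun t => _) = (fun t => - B t j i)); last first.
    by apply/funext => s; rewrite !mxE.
  by apply: continuousN; exact: Bc.
- by rewrite !mxE normrN.
have dPsi (t : R) : is_derive t 1 (fun s => (Th s)^T) (- ((Th t)^T *m B t)).
  by have := is_derive_trmx (dTh t); rewrite mulNmx linearN/= trmx_mul trmxK.
exists Phi, (fun t => (Th t)^T); split=> //; first by rewrite Th0 trmx1.
move=> t; rewrite -[RHS]mulmx1 -{2}Phi0 -[X in X *m Phi 0]trmx1 -Th0.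
apply: (@is_derive_mx_const _ _ _ (fun t => (Th t)^T *m Phi t)) => s.
have := is_derive_mulmx (dPsi s) (dPhi s).
by rewrite mulNmx mulmxA addNr.
Qed.

Section FundamentalPairTheory.
Context (R : realType) (m : nat) (B Phi Psi : R -> 'M[R]_m)
  (pair : fundamental_pair B Phi Psi).

Lemma fundKr t : Phi t *m Psi t = 1%:M.
Proof. by rewrite mulmx1C// (fundK pair). Qed.

Lemma fund_evolution : evolution_operator B (fun t s => Phi t *m Psi s).
Proof.
split=> [s|s x0 t|x xB t s]; first exact: fundKr.
  rewrite !mulmxA.
  have := is_derive_mulmx_const (Psi s *m x0) (fund_derive pair t).
  by rewrite !mulmxA; under eq_fun do rewrite mulmxA.
have c : Psi t *m x t = Psi s *m x s.
  apply: (@is_derive_mx_const _ _ _ (fun r => Psi r *m x r)) => r.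
  have := is_derive_mulmx (fund_inv_derive pair r) (xB r).
  by rewrite mulNmx mulmxA addNr.
by rewrite -mulmxA -c mulmxA fundKr mul1mx.
Qed.

Lemma evolutionE T : evolution_operator B T -> forall t s, T t s = Phi t *m Psi s.
Proof.
move=> ET t s; apply/trmx_inj/row_matrixP => j; apply: trmx_inj.
rewrite -!tr_col !trmxK !colE.
rewrite (evolution_unique fund_evolution (evolution_solution ET s _) t s).
by rewrite (evolution_id ET) mul1mx.
Qed.

Lemma fund_unit t : Phi t \in unitmx.
Proof. by have /mulmx1_unit[] := fundKr t. Qed.

Lemma fund_inv_unit t : Psi t \in unitmx.
Proof. by have /mulmx1_unit[] := fundKr t. Qed.

Lemma invmx_fund t s : invmx (Phi t *m Psi s) = Phi s *m Psi t.
Proof.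
have U : Phi t *m Psi s \in unitmx by rewrite unitmx_mul fund_unit fund_inv_unit.
apply: (can_inj (mulKmx U)); rewrite mulmxV//.
by rewrite mulmxA -(mulmxA (Phi t)) (fundK pair) mulmx1 fundKr.
Qed.

End FundamentalPairTheory.

(** * Tools for the dichotomy *)

(** Gronwall's inequality, by monotonicity of [expR (eta * x) * f x]. The rate
    [eta] may be negative, in which case it describes exponential growth. *)
Lemma exp_decay (R : realType) (f df : R -> R) (eta s t : R) :
  (forall x : R, is_derive x 1 f (df x)) ->
  (forall x, s < x -> df x <= - eta * f x) -> s <= t ->
  f t <= expR (- eta * (t - s)) * f s.
Proof.
move=> dfx fle st.
have exp_d (x : R) : is_derive x 1 (fun y => expR (eta * y)) (eta * expR (eta * x)).
  have := is_derive1_comp (is_derive_expR (eta * x))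
    (is_derive_scale eta (is_derive_id x 1)).
  by rewrite mulr1 mulrC.
have : expR (eta * t) * f t <= expR (eta * s) * f s.
  apply: (@nonincreasing_of_derive _ (fun x => expR (eta * x) * f x)
    (fun x => (eta * expR (eta * x)) * f x + expR (eta * x) * df x)) => //.
    by move=> x _; exact: is_derive_mul (exp_d x) (dfx x).
  move=> x /andP[sx _]; have := fle x sx => h.
  have := expR_gt0 (eta * x) => e0.
  rewrite -mulrA (mulrC eta) -mulrA -mulrDr pmulr_rle0//; lra.
rewrite -ler_pdivlMl ?expR_gt0// => h; apply: le_trans h _.
by rewrite -expRN mulrA -expRD; have -> : - (eta * t) + eta * s = - eta * (t - s) by ring.
Qed.

(** The compactness principle behind the construction of the stable space: a
    bounded sequence of vectors has a point that satisfies every closed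
    condition which holds for all late terms. *)
Lemma bounded_seq_limit (R : realType) (m : nat) (u : nat -> 'rV[R]_m) (c : R) :
  (forall k i, `|u k 0 i| <= c) ->
  exists p : 'rV[R]_m, forall q : 'rV[R]_m -> R, continuous q ->
    (exists N, forall k, (N <= k)%N -> 0 <= q (u k)) -> 0 <= q p.
Proof.
move=> uc.
have cK := @rV_compact R m (fun=> `[- c, c]%classic) (fun=> @segment_compact R (- c) c).
have [|p [_ clp]] := cK (u @ \oo) _.
  by exists 0%N => // k _ i /=; rewrite in_itv/= -ler_norml.
exists p => q qc [N qN]; rewrite leNgt; apply/negP => qp.
have uN : (u @ \oo) [set r | 0 <= q r] by exists N => // k; exact: qN.
have pN : nbhs p [set r | q r < 0].
  exact: (qc p [set x | x < 0] (lt_nbhsl qp)).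
by have [r /= [r1 r2]] := clp _ _ uN pN; move: r1; rewrite leNgt r2.
Qed.

(** The estimate by which a vector [u] on which the Lyapunov form is definite is
    controlled by a vector [v], once the sign of the form at [u + v] is known. *)
Lemma le_of_quadratic (R : realType) (k b u v : R) :
  0 < k -> 0 <= b -> 0 <= u -> 0 <= v ->
  k * u ^+ 2 <= b * v ^+ 2 + 2 * b * v * u -> u <= (2 * b / k + 1) * v.
Proof.
move=> k0 b0 u0 v0 h; rewrite leNgt; apply/negP => vu.
have kc : k * ((2 * b / k + 1) * v) = 2 * b * v + k * v by field; rewrite gt_eqF.
have c1 : v <= (2 * b / k + 1) * v.
  by rewrite ler_peMl// lerDr divr_ge0// ?mulr_ge0// ltW.
have u1 : 0 < u by apply: le_lt_trans vu; exact: le_trans c1.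
have : k * ((2 * b / k + 1) * v) * u < k * u * u.
  by rewrite ltr_pM2r// ltr_pM2l.
rewrite kc => h2.
have vu' : v <= u by apply: le_trans c1 (ltW vu).
have h3 : k * (2 * b * v + k * v) <= k * (k * u).
  by rewrite ler_pM2l// -kc ler_pM2l// ltW.
have h4 : (2 * b * v + k * v) * v <= k * u * v.
  by apply: ler_wpM2r => //; rewrite -(ler_pM2l k0).
have h5 : 0 <= b * v * v by rewrite !mulr_ge0.
have h6 : 0 <= k * v * v by rewrite !mulr_ge0// ltW.
rewrite !expr2 in h; lra.
Qed.

(** * Exponential dichotomy from a Lyapunov form *)

(** A certificate for the dichotomy of [x' = B x]. By [lyap_decr] the form
    [dot x (Q t *m x)] decreases along solutions; the stable solutions will be
    those on which it stays nonnegative, the unstable ones those on which it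
    starts negative. The projector [J] records the signature of the form:
    positivity on its range is needed at all times, because the stable space is
    obtained from solutions that end in the range at a late time, whereas
    negativity on its kernel is needed only at time [0]. [Q t] is not assumed
    symmetric. *)
Record lyapunov_form (R : realType) (m : nat) (B Q dQ : R -> 'M[R]_m)
    (J : 'M[R]_m) (delta b M : R) : Prop := LyapunovForm {
  lyap_delta : 0 < delta;
  lyap_b : 0 < b;
  lyap_derive : forall t : R, is_derive t 1 Q (dQ t);
  lyap_coef : forall t x, 0 < t -> enorm (B t *m x) <= M * enorm x;
  lyap_bound : forall t x y, 0 <= t ->
    `|dot x (Q t *m y)| <= b * (enorm x * enorm y);
  lyap_decr : forall t x, 0 < t ->
    dot (B t *m x) (Q t *m x) + dot x (dQ t *m x + Q t *m (B t *m x))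
      <= - delta * dot x x;
  lyap_idem : J *m J = J;
  lyap_range : forall t x, 0 <= t -> J *m x = x -> dot x x <= dot x (Q t *m x);
  lyap_kernel : forall x, J *m x = 0 -> dot x (Q 0 *m x) <= - dot x x }.

Section LyapunovDichotomy.
Context (R : realType) (m : nat) (B Phi Psi Q dQ : R -> 'M[R]_m) (J : 'M[R]_m)
  (delta b M : R) (pair : fundamental_pair B Phi Psi)
  (lyap : lyapunov_form B Q dQ J delta b M).

Let W (x : 'cV[R]_m) t := dot (Phi t *m x) (Q t *m (Phi t *m x)).
Let N (x : 'cV[R]_m) t := dot (Phi t *m x) (Phi t *m x).

(* small enough for [W + kappa * N] and [W - kappa * N] to decrease too *)
Let kappa := delta / (4 * (`|M| + 1) + delta).

Let dlt0 : 0 < delta. Proof. exact: lyap_delta lyap. Qed.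
Let b0 : 0 < b. Proof. exact: lyap_b lyap. Qed.
Let den0 : 0 < 4 * (`|M| + 1) + delta.
Proof. by rewrite addr_gt0// mulr_gt0// ltr_pwDr. Qed.
Let kappa0 : 0 < kappa. Proof. by rewrite divr_gt0. Qed.
Let kappa1 : kappa <= 1.
Proof. by rewrite ler_pdivrMr// mul1r lerDr mulr_ge0// addr_ge0. Qed.
Let kappaM : 2 * kappa * M <= delta / 2.
Proof.
have h : kappa * (4 * (`|M| + 1) + delta) = delta by rewrite divfK// gt_eqF.
have h1 : kappa * M <= kappa * `|M| by rewrite ler_pM2l// ler_norm.
have h2 : 0 <= kappa * delta by rewrite mulr_ge0// ltW.
by have := ltW kappa0; move: h; rewrite mulrDr => h h3; lra.
Qed.

Let N_ge0 x t : 0 <= N x t. Proof. exact: dot_ge0. Qed.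

Let dX (x : 'cV[R]_m) (t : R) : is_derive t 1 (fun s => Phi s *m x) (B t *m (Phi t *m x)).
Proof. by rewrite mulmxA; exact: is_derive_mulmx_const (fund_derive pair t). Qed.

Let dN (x : 'cV[R]_m) (t : R) :
  is_derive t 1 (N x) (2 * dot (Phi t *m x) (B t *m (Phi t *m x))).
Proof.
rewrite mulrDl mul1r {1}dotC; exact: is_derive_dot (dX x t) (dX x t).
Qed.

Let dN_bound (x : 'cV[R]_m) t : 0 < t ->
  `|kappa * (2 * dot (Phi t *m x) (B t *m (Phi t *m x)))| <= delta / 2 * N x t.
Proof.
move=> t0; set y := Phi t *m x.
have h : `|dot y (B t *m y)| <= M * N x t.
  apply: le_trans (cauchy_schwarz _ _) _; rewrite /N -enorm_sqr expr2 mulrCA.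
  by rewrite ler_wpM2l ?enorm_ge0// (lyap_coef lyap).
rewrite normrM (normrM 2) [`|2|]ger0_norm// [`|kappa|]gtr0_norm//.
apply: (@le_trans _ _ (2 * kappa * M * N x t)); last by rewrite ler_wpM2r.
have : kappa * `|dot y (B t *m y)| <= kappa * (M * N x t) by rewrite ler_pM2l.
lra.
Qed.

Let dWt (x : 'cV[R]_m) t := dot (B t *m (Phi t *m x)) (Q t *m (Phi t *m x)) +
  dot (Phi t *m x) (dQ t *m (Phi t *m x) + Q t *m (B t *m (Phi t *m x))).

Let dW (x : 'cV[R]_m) (t : R) : is_derive t 1 (W x) (dWt x t).
Proof.
exact: is_derive_dot (dX x t) (is_derive_mulmx (lyap_derive lyap t) (dX x t)).
Qed.

Let dW_le (x : 'cV[R]_m) t : 0 < t -> dWt x t <= - delta * N x t.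
Proof. by move=> t0; exact: (lyap_decr lyap). Qed.

Let W_bound (x : 'cV[R]_m) t : 0 <= t -> `|W x t| <= b * N x t.
Proof.
by move=> t0; rewrite /N -enorm_sqr expr2; exact: (lyap_bound lyap).
Qed.

Let Wp (x : 'cV[R]_m) t := W x t + kappa * N x t.
Let Wm (x : 'cV[R]_m) t := W x t - kappa * N x t.

Let dWp (x : 'cV[R]_m) (t : R) : is_derive t 1 (Wp x)
  (dWt x t + kappa * (2 * dot (Phi t *m x) (B t *m (Phi t *m x)))).
Proof. by apply: is_derive_add; [exact: dW|exact: is_derive_scale (dN x t)]. Qed.

Let dWm (x : 'cV[R]_m) (t : R) : is_derive t 1 (Wm x)
  (dWt x t - kappa * (2 * dot (Phi t *m x) (B t *m (Phi t *m x)))).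
Proof. by apply: is_derive_sub; [exact: dW|exact: is_derive_scale (dN x t)]. Qed.

Let dWp_le (x : 'cV[R]_m) t : 0 < t ->
  dWt x t + kappa * (2 * dot (Phi t *m x) (B t *m (Phi t *m x)))
    <= - (delta / 2) * N x t.
Proof.
move=> t0; have := dW_le x t0; have := dN_bound x t0.
by rewrite ler_norml => /andP[? ?] ?; lra.
Qed.

Let dWm_le (x : 'cV[R]_m) t : 0 < t ->
  dWt x t - kappa * (2 * dot (Phi t *m x) (B t *m (Phi t *m x)))
    <= - (delta / 2) * N x t.
Proof.
move=> t0; have := dW_le x t0; have := dN_bound x t0.
by rewrite ler_norml => /andP[? ?] ?; lra.
Qed.

Let dN0 (x : 'cV[R]_m) t : - (delta / 2) * N x t <= 0.
Proof. by rewrite mulr_le0_ge0// oppr_le0 divr_ge0// ltW. Qed.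

Let Wp_decr x s t : 0 <= s -> s <= t -> Wp x t <= Wp x s.
Proof.
move=> s0 st; apply: (nonincreasing_of_derive (fun y _ => dWp x y) _ st) => y.
by move=> /andP[sy _]; apply: le_trans (dWp_le x (le_lt_trans s0 sy)) (dN0 x y).
Qed.

Let Wm_decr x s t : 0 <= s -> s <= t -> Wm x t <= Wm x s.
Proof.
move=> s0 st; apply: (nonincreasing_of_derive (fun y _ => dWm x y) _ st) => y.
by move=> /andP[sy _]; apply: le_trans (dWm_le x (le_lt_trans s0 sy)) (dN0 x y).
Qed.

Let W_decr x s t : 0 <= s -> s <= t -> W x t <= W x s.
Proof.
move=> s0 st; apply: (nonincreasing_of_derive (fun y _ => dW x y) _ st) => y.
move=> /andP[sy _]; apply: le_trans (dW_le x (le_lt_trans s0 sy)) _.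
by rewrite mulNr oppr_le0 mulr_ge0// ltW.
Qed.

Let forward_bounded x := exists C, forall t, 0 <= t -> N x t <= C.

(* a negative value of [Wm] would grow exponentially in absolute value, while
   [Wm] is bounded by a multiple of [N] *)
Let bounded_Wm_ge0 x : forward_bounded x -> forall t, 0 <= t -> 0 <= Wm x t.
Proof.
move=> [C NC] t t0; rewrite leNgt; apply/negP => Wt.
pose rho := delta / 2 / (b + kappa).
have bk0 : 0 < b + kappa by rewrite addr_gt0.
have rho0 : 0 < rho by rewrite !divr_gt0.
have WN y : 0 <= y -> - Wm x y <= (b + kappa) * N x y.
  move=> y0; have := W_bound x y0; rewrite ler_norml /Wm mulrDl => /andP[h _]; lra.
have C0 : 0 <= C by apply: le_trans (NC 0 (lexx 0)); exact: N_ge0.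
pose T := t + ((b + kappa) * C / - Wm x t) / rho + 1.
have q0 : 0 <= ((b + kappa) * C / - Wm x t) / rho.
  by rewrite !divr_ge0// ?mulr_ge0// ?oppr_ge0 ltW.
have tT : t <= T by rewrite /T; lra.
have h := @exp_decay R (Wm x) _ (- rho) t T (dWm x) _ tT.
have {h} : Wm x T <= expR (rho * (T - t)) * Wm x t.
  rewrite -[X in expR (X * _)]opprK; apply: h => y ty.
  apply: le_trans (dWm_le x (le_lt_trans t0 ty)) _.
  rewrite opprK mulNr lerNl -mulrN.
  apply: le_trans (ler_wpM2l (ltW rho0) (WN y (le_trans t0 (ltW ty)))) _.
  by rewrite /rho mulrA divfK// gt_eqF.
have : 1 + rho * (T - t) <= expR (rho * (T - t)) by exact: expR_ge1Dx.
have -> : rho * (T - t) = (b + kappa) * C / - Wm x t + rho.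
  have eT (r q : R) : r != 0 -> r * (t + q / r + 1 - t) = q + r by move=> r1; field.
  by apply: eT; rewrite gt_eqF.
move=> h1 h2; have := WN T (le_trans t0 tT).
have := ler_wpM2l (ltW bk0) (NC T (le_trans t0 tT)).
have : (1 + ((b + kappa) * C / - Wm x t + rho)) * - Wm x t
    <= expR ((b + kappa) * C / - Wm x t + rho) * - Wm x t.
  by rewrite ler_pM2r ?oppr_gt0.
rewrite [X in X <= _](_ : _ = - Wm x t + (b + kappa) * C - rho * Wm x t).
  have : rho * Wm x t < 0 by rewrite pmulr_rlt0.
  by rewrite mulrN; lra.
have eW (w r q : R) : w != 0 -> (1 + (q / - w + r)) * - w = - w + q - r * w.
  by move=> w1; field.
by apply: eW; rewrite lt_eqF.
Qed.

Let rate := delta / (2 * b).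
Let cst := Num.sqrt (b / kappa).

Let cst_sqr t : (cst * expR (- rate * t)) ^+ 2 = b / kappa * expR (- (delta / b) * t).
Proof.
rewrite exprMn sqr_sqrtr ?divr_ge0 ?ltW// expr2 -expRD; congr (_ * expR _).
by rewrite /rate; field; rewrite gt_eqF.
Qed.

(* [kappa * N <= W <= b * N] along a bounded solution, so the decay of [W] passes
   to [N] *)
Let bounded_decay x s t : forward_bounded x -> 0 <= s -> s <= t ->
  enorm (Phi t *m x) <= cst * expR (- rate * (t - s)) * enorm (Phi s *m x).
Proof.
move=> bx s0 st; apply: enorm_le; first by rewrite mulr_ge0 ?sqrtr_ge0 ?expR_ge0.
rewrite cst_sqr -/(N x t) -/(N x s).
have Wle : W x t <= expR (- (delta / b) * (t - s)) * W x s.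
  apply: (exp_decay (dW x)) => // y sy; have y0 := le_lt_trans s0 sy.
  apply: le_trans (dW_le x y0) _; rewrite !mulNr lerN2 -mulrA ler_pM2l//.
  rewrite ler_pdivrMl//; apply: le_trans (W_bound x (ltW y0)); exact: ler_norm.
have := bounded_Wm_ge0 bx (le_trans s0 st); rewrite /Wm subr_ge0 => Nt.
rewrite -(ler_pM2l kappa0); apply: le_trans Nt _; apply: le_trans Wle _.
have -> : kappa * (b / kappa * expR (- (delta / b) * (t - s)) * N x s) =
    expR (- (delta / b) * (t - s)) * (b * N x s).
  have eq (k e n : R) : k != 0 -> k * (b / k * e * n) = e * (b * n).
    by move=> k0; field.
  by apply: eq; rewrite gt_eqF.
rewrite ler_pM2l ?expR_gt0//; apply: le_trans (W_bound x s0); exact: ler_norm.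
Qed.

Let kernel_Wp_le0 x t : J *m x = 0 -> 0 <= t -> Wp x t <= 0.
Proof.
move=> Jx t0; apply: le_trans (Wp_decr x (lexx 0) t0) _.
rewrite /Wp /W /N (fund0 pair) !mul1mx.
have := lyap_kernel lyap Jx; have := dot_ge0 x; have := kappa1 => k1 x0.
have : kappa * dot x x <= dot x x by rewrite ler_piMl.
lra.
Qed.

(* [kappa * N <= - W <= b * N] along a solution that starts in the kernel *)
Let kernel_growth x s t : J *m x = 0 -> 0 <= s -> s <= t ->
  enorm (Phi s *m x) <= cst * expR (- rate * (t - s)) * enorm (Phi t *m x).
Proof.
move=> Jx s0 st; apply: enorm_le; first by rewrite mulr_ge0 ?sqrtr_ge0 ?expR_ge0.
rewrite cst_sqr -/(N x t) -/(N x s).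
have Wle : W x t <= expR (- - (delta / b) * (t - s)) * W x s.
  apply: (exp_decay (dW x)) => // y sy; have y0 := le_lt_trans s0 sy.
  apply: le_trans (dW_le x y0) _; rewrite opprK mulNr lerNl -mulrN -mulrA ler_pM2l//.
  rewrite ler_pdivrMl//; apply: le_trans (W_bound x (ltW y0)).
  by rewrite -normrN; exact: ler_norm.
have := kernel_Wp_le0 Jx s0; rewrite /Wp => Ns.
have {}Ns : kappa * N x s <= - W x s by lra.
rewrite -(ler_pM2l kappa0); apply: le_trans Ns _.
have e0 := expR_gt0 (- - (delta / b) * (t - s)).
rewrite -(ler_pM2l e0) mulrN; apply: (@le_trans _ _ (- W x t)); first by rewrite lerN2.
have ee : expR (- - (delta / b) * (t - s)) * expR (- (delta / b) * (t - s)) = 1.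
  by rewrite -expRD -[RHS]expR0; congr expR; ring.
have eq (k e e' n : R) : k != 0 -> e * e' = 1 -> e * (k * (b / k * e' * n)) = b * n.
  move=> k0 e1; have -> : e * (k * (b / k * e' * n)) = e * e' * (b * n) by field.
  by rewrite e1 mul1r.
rewrite eq ?gt_eqF//.
apply: le_trans (W_bound x (le_trans s0 st)).
by rewrite -normrN; exact: ler_norm.
Qed.

(* the compressed operator (1 - J) Phi (1 - J) on the kernel of J, completed by
   the identity on the range of J *)
Let Mk t := (1%:M - J) *m Phi t *m (1%:M - J) + J.

Let JJ : J *m J = J. Proof. exact: lyap_idem lyap. Qed.
Let JK : J *m (1%:M - J) = 0. Proof. by rewrite mulmxBr mulmx1 JJ subrr. Qed.
Let kerK (x : 'cV[R]_m) : J *m x = 0 -> (1%:M - J) *m x = x.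
Proof. by move=> Jx; rewrite mulmxBl mul1mx Jx subr0. Qed.
Let JMk t : J *m Mk t = J.
Proof. by rewrite /Mk mulmxDr !mulmxA JK !mul0mx add0r JJ. Qed.

(* a vector of the kernel cannot be transported into the range, where the form
   is nonnegative *)
Let Mk_unit t : 0 <= t -> Mk t \in unitmx.
Proof.
move=> t0; rewrite -unitmx_tr -row_free_unit -kermx_eq0.
apply/eqP/row_matrixP => i; rewrite row0; apply: trmx_inj; rewrite trmx0.
set x := (row i _)^T.
have Mx : Mk t *m x = 0.
  apply: trmx_inj; rewrite trmx_mul trmxK trmx0.
  by apply/sub_kermxP; exact: row_sub.
have Jx : J *m x = 0 by rewrite -(JMk t) -mulmxA Mx mulmx0.
have : J *m (Phi t *m x) = Phi t *m x.
  apply/eqP; rewrite eq_sym -subr_eq0 -[X in X - _]mul1mx -mulmxBl; apply/eqP.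
  by move: Mx; rewrite /Mk mulmxDl Jx addr0 -!mulmxA (kerK Jx).
move=> /(lyap_range lyap t0) h1; have := kernel_Wp_le0 Jx t0.
rewrite /Wp /W => h2; have h3 := N_ge0 x t.
have : N x t = 0.
  apply/eqP; rewrite eq_le h3 andbT; have : 0 <= kappa * N x t by rewrite mulr_ge0// ltW.
  by rewrite /N in h1 h2 *; lra.
move=> /eqP; rewrite dot_eq0 => /eqP Px.
by rewrite -[x]mul1mx -(fundK pair t) -mulmxA Px mulmx0.
Qed.

Let initial_le v u : J *m u = 0 -> 0 <= W (v + u) 0 ->
  enorm u <= (2 * b / 1 + 1) * enorm v.
Proof.
move=> Ju; rewrite /W (fund0 pair) !mul1mx mulmxDr !(dotDl, dotDr) => h.
apply: le_of_quadratic; rewrite ?enorm_ge0//; first exact: ltW.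
have hu := lyap_kernel lyap Ju.
have := lyap_bound lyap v v (lexx 0); have := lyap_bound lyap v u (lexx 0).
have := lyap_bound lyap u v (lexx 0).
rewrite !ler_norml -!enorm_sqr in hu * => /andP[? ?] /andP[? ?] /andP[? ?].
rewrite !expr2 in hu *; lra.
Qed.

Let quadratic_continuous v t : continuous (fun r : 'rV[R]_m => Wm (v + r^T) t).
Proof.
pose G := (Phi t)^T *m (Q t *m Phi t) - kappa *: ((Phi t)^T *m Phi t).
rewrite (_ : (fun r => _) = (fun r : 'rV[R]_m =>
    \sum_i (v i 0 + r 0 i) * \sum_j G i j * (v j 0 + r 0 j))).
  have c i : continuous (fun r : 'rV[R]_m => v i 0 + r 0 i).
    by move=> r; apply: continuousD; [exact: cst_continuous|exact: coord_continuous].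
  have cG i j : continuous (fun r : 'rV[R]_m => G i j * (v j 0 + r 0 j)).
    move=> r; apply: (@continuousM R 'rV[R]_m (fun=> G i j)); last exact: c.
    exact: cst_continuous.
  apply: continuous_big => [|i _ r]; first exact: add_continuous.
  apply: (@continuousM _ _ (fun q : 'rV[R]_m => v i 0 + q 0 i)
    (fun q => \sum_j G i j * (v j 0 + q 0 j))); first exact: c.
  move: r; apply: continuous_big => [|j _ r]; first exact: add_continuous.
  exact: cG.
apply/funext => r; set x := v + _.
have -> : Wm x t = dot x (G *m x).
  rewrite /Wm /W /N !dot_mull /G mulmxBl dotDr dotNr -scalemxAl dotZr.
  by rewrite !mulmxA.
rewrite dotE; apply: eq_bigr => i _; rewrite !mxE; congr (_ * _).
by apply: eq_bigr => j _; rewrite !mxE.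
Qed.

(** Choose [u_k] in the kernel so that [v + u_k] is transported into the range of
    [J] at time [k]; the form is then nonnegative on [0, k], which bounds [u_k],
    and a limit point inherits the inequality for all times. *)
Let stable_completion v : J *m v = v ->
  exists u, J *m u = 0 /\ forward_bounded (v + u).
Proof.
move=> Jv; pose u k := - (invmx (Mk k) *m ((1%:M - J) *m (Phi k *m v))).
have Ju (k : nat) : J *m u k%:R = 0.
  have -> : J *m u k%:R = - (J *m invmx (Mk k%:R) *m (1%:M - J) *m (Phi k%:R *m v)).
    by rewrite /u mulmxN !mulmxA.
  have -> : J *m invmx (Mk k%:R) = J by rewrite -{1}(JMk k%:R) mulmxK// Mk_unit.
  by rewrite JK mul0mx oppr0.
have range (k : nat) : J *m (Phi k%:R *m (v + u k%:R)) = Phi k%:R *m (v + u k%:R).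
  apply/eqP; rewrite eq_sym -subr_eq0 -[X in X - _]mul1mx -mulmxBl; apply/eqP.
  have : Mk k%:R *m u k%:R = - ((1%:M - J) *m (Phi k%:R *m v)).
    by rewrite /u mulmxN mulKVmx// Mk_unit.
  rewrite /Mk mulmxDl Ju addr0 -!mulmxA (kerK (Ju k)) => h.
  by rewrite !mulmxDr h addrN.
have Wm_ge0 (k : nat) t : 0 <= t -> t <= k%:R -> 0 <= Wm (v + u k%:R) t.
  move=> t0 tk; apply: le_trans (Wm_decr _ t0 tk).
  rewrite /Wm subr_ge0; apply: le_trans (lyap_range lyap (ler0n _ k) (range k)).
  by rewrite ler_piMl.
pose r (k : nat) := (u k%:R)^T.
have rb k i : `|r k 0 i| <= (2 * b / 1 + 1) * enorm v.
  rewrite mxE; apply: le_trans (entry_le_enorm _ _) _.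
  apply: initial_le => //; have := Wm_ge0 k 0 (lexx 0) (ler0n _ k).
  by rewrite /Wm subr_ge0; apply: le_trans; rewrite mulr_ge0// ltW.
have [p pP] := bounded_seq_limit rb.
have pWm t : 0 <= t -> 0 <= Wm (v + p^T) t.
  move=> t0; apply: (pP (fun q => Wm (v + q^T) t)); first exact: quadratic_continuous.
  exists (Num.truncn t).+1 => k tk; rewrite /r trmxK; apply: Wm_ge0 => //.
  by apply: le_trans (ltW (truncnS_gt t)) _; rewrite ler_nat.
have cJ i j : continuous (fun q : 'rV[R]_m => J i j * q 0 j).
  move=> q; apply: (@continuousM R 'rV[R]_m (fun=> J i j)).
    exact: cst_continuous.
  exact: coord_continuous.
have linc i : continuous (fun q : 'rV[R]_m => (J *m q^T) i 0).
  rewrite (_ : (fun q => _) = (fun q : 'rV[R]_m => \sum_j J i j * q 0 j)).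
    apply: continuous_big => [|j _ q]; first exact: add_continuous.
    exact: cJ.
  by apply/funext => q; rewrite mxE; apply: eq_bigr => j _; rewrite mxE.
exists p^T; split.
  apply/colP => i; rewrite [RHS]mxE; apply: le_anti; apply/andP; split.
    rewrite -oppr_ge0; apply: (pP (fun q => - (J *m q^T) i 0)) => [q|].
      by apply: continuousN; exact: linc.
    by exists 0%N => k _; rewrite trmxK Ju mxE oppr0.
  apply: (pP (fun q => (J *m q^T) i 0)) => //.
  by exists 0%N => k _; rewrite trmxK Ju mxE.
exists (W (v + p^T) 0 / kappa) => t t0; rewrite ler_pdivlMr// mulrC.
have := pWm t t0; have := W_decr (v + p^T) (lexx 0) t0.
rewrite /Wm; lra.
Qed.

(* boundedness, unlike the sign condition on the form, is visibly linear *)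
Let bounded_add x y : forward_bounded x -> forward_bounded y -> forward_bounded (x + y).
Proof.
move=> [C xC] [D yD]; exists (2 * C + 2 * D) => t t0.
have := xC t t0; have := yD t t0.
have : N (x + y) t + N (x - y) t = 2 * N x t + 2 * N y t.
  by rewrite /N !(mulmxDr, mulmxN, dotDl, dotDr, dotNl, dotNr); ring.
by have := N_ge0 (x - y) t; lra.
Qed.

Let bounded_scale a x : forward_bounded x -> forward_bounded (a *: x).
Proof.
move=> [C xC]; exists (a ^+ 2 * C) => t t0.
rewrite /N -scalemxAr dotZl dotZr mulrA -expr2 ler_wpM2l ?sqr_ge0//.
exact: xC.
Qed.

Let bounded_kernel_eq0 x : J *m x = 0 -> forward_bounded x -> x = 0.
Proof.
move=> Jx bx; have := bounded_Wm_ge0 bx (lexx 0).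
have := kernel_Wp_le0 Jx (lexx 0); rewrite /Wp /Wm => h1 h2.
have : kappa * N x 0 <= 0 by lra.
rewrite pmulr_rle0// /N (fund0 pair) mul1mx => h.
by apply/eqP; rewrite -dot_eq0 eq_le h dot_ge0.
Qed.

(** The projector at time [0] onto the bounded solutions along the kernel of [J]. *)
Let stable_projector : exists P0 : 'M[R]_m,
  [/\ J *m P0 = J, P0 *m J = P0 & forall x, forward_bounded (P0 *m x)].
Proof.
have colM (A C : 'M[R]_m) j : col j (A *m C) = A *m col j C by rewrite !colE mulmxA.
have ex j : exists u, J *m u = 0 /\ forward_bounded (col j J + u).
  by apply: stable_completion; rewrite -colM JJ.
have [u uP] := choice ex.
pose P0 : 'M[R]_m := \matrix_(i, j) (J i j + u j i 0).
have P0col j : col j P0 = col j J + u j by apply/colP => i; rewrite !mxE.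
have P0x x : P0 *m x = \sum_j x j 0 *: (col j J + u j).
  apply/colP => i; rewrite summxE mxE; apply: eq_bigr => j _.
  by rewrite !mxE mulrC.
have P0b x : forward_bounded (P0 *m x).
  rewrite P0x; elim/big_ind: _ => [|y z|j _]; [|exact: bounded_add|].
    by exists 0 => t _; rewrite /N mulmx0 dot0r.
  by apply: bounded_scale; case: (uP j).
have JP0 : J *m P0 = J.
  apply/trmx_inj/row_matrixP => j; apply: trmx_inj; rewrite -!tr_col !trmxK.
  by rewrite colM P0col mulmxDr -colM JJ (uP j).1 addr0.
exists P0; split=> //.
apply/trmx_inj/row_matrixP => j; apply: trmx_inj; rewrite -!tr_col !trmxK !colE.
apply/eqP; rewrite -subr_eq0 -mulmxBl; apply/eqP/bounded_kernel_eq0.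
  by rewrite mulmxA mulmxBr mulmxA JP0 JJ subrr mul0mx.
rewrite mulmxBl -mulmxA; apply: bounded_add => //.
by rewrite -scaleN1r; exact: bounded_scale.
Qed.

(** The bounded solutions are those on which the form stays nonnegative, and they
    decay like the form; the solutions starting in the kernel of [J] keep it
    negative and grow. The two families are complementary at time [0], and the
    opposite signs of the form keep the angle between them bounded below. *)
Theorem lyapunov_dichotomy : exists P,
  exp_dichotomy (fun t s => Phi t *m Psi s) P /\ forall t, \rank (P t) = \rank J.
Proof.
have [P0 [JP0 P0J P0b]] := stable_projector.
have P00 : P0 *m P0 = P0 by rewrite -{1}P0J -mulmxA JP0.
have K1 t : Psi t *m Phi t = 1%:M := fundK pair t.
have K2 t : Phi t *m Psi t = 1%:M := fundKr pair t.
pose P t := Phi t *m P0 *m Psi t.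
have compl t : 1%:M - P t = Phi t *m (1%:M - P0) *m Psi t.
  by rewrite mulmxBr mulmx1 mulmxBl K2.
have ker (x : 'cV[R]_m) : J *m ((1%:M - P0) *m x) = 0.
  by rewrite mulmxA mulmxBr mulmx1 JP0 subrr mul0mx.
pose D := 2 * b / kappa + 1.
have D0 : 0 <= D.
  by apply: addr_ge0 => //; apply: divr_ge0; [apply: mulr_ge0 => //|]; exact: ltW.
(* at each time the form separates the two ranges, so the projectors are bounded *)
have bounds t (x : 'cV[R]_m) : 0 <= t -> enorm (P t *m x) <= D * enorm x /\
    enorm ((1%:M - P t) *m x) <= D * enorm x.
  move=> t0; pose y := P0 *m (Psi t *m x); pose z := (1%:M - P0) *m (Psi t *m x).
  have Py : P t *m x = Phi t *m y by rewrite /P /y !mulmxA.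
  have Pz : (1%:M - P t) *m x = Phi t *m z by rewrite compl /z !mulmxA.
  have xyz : x = Phi t *m y + Phi t *m z.
    by rewrite -Py -Pz -mulmxDl addrC subrK mul1mx.
  have Wy : 0 <= Wm y t by exact: bounded_Wm_ge0 (P0b _) t t0.
  have Wz : Wp z t <= 0 by exact: kernel_Wp_le0 (ker _) t0.
  rewrite Py Pz; move: Wy Wz; rewrite /Wm /Wp /W /N.
  set p := Phi t *m y; set q := Phi t *m z; rewrite -!enorm_sqr => Wy Wz.
  have := lyap_bound lyap p x t0; have := lyap_bound lyap x p t0.
  have := lyap_bound lyap q x t0; have := lyap_bound lyap x q t0.
  have := lyap_bound lyap x x t0; rewrite !ler_norml.
  move=> /andP[? ?] /andP[? ?] /andP[? ?] /andP[? ?] /andP[? ?].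
  have qE : q = x - p by rewrite xyz addrC addKr.
  have pE : p = x - q by rewrite xyz addrK.
  have eq1 : dot q (Q t *m q) = dot x (Q t *m x) - dot x (Q t *m p) -
      dot p (Q t *m x) + dot p (Q t *m p).
    by rewrite {1 2}qE !(mulmxBr, dotDl, dotDr, dotNl, dotNr); ring.
  have eq2 : dot p (Q t *m p) = dot x (Q t *m x) - dot x (Q t *m q) -
      dot q (Q t *m x) + dot q (Q t *m q).
    by rewrite {1 2}pE !(mulmxBr, dotDl, dotDr, dotNl, dotNr); ring.
  have ep := mulr_ge0 (ltW kappa0) (sqr_ge0 (enorm p)).
  have eqq := mulr_ge0 (ltW kappa0) (sqr_ge0 (enorm q)).
  have b0' := ltW b0.
  split; apply: le_of_quadratic; rewrite ?enorm_ge0//;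
    by rewrite !expr2 in Wy Wz ep eqq *; lra.
exists P; split; last first.
  move=> t; apply/eqP; rewrite eqn_leq; apply/andP; split.
    apply: leq_trans (mxrankM_maxl _ _) _; apply: leq_trans (mxrankM_maxr _ _) _.
    by rewrite -P0J mxrankM_maxr.
  have -> : J = J *m Psi t *m P t *m Phi t.
    by rewrite /P !mulmxA -(mulmxA J) K1 mulmx1 -(mulmxA (J *m P0)) K1 mulmx1 JP0.
  by apply: leq_trans (mxrankM_maxl _ _) _; exact: mxrankM_maxr.
split=> [t _|t s _ _|].
- by rewrite /P !mulmxA -(mulmxA (_ *m P0)) K1 mulmx1 -(mulmxA _ P0 P0) P00.
- rewrite /P !mulmxA -(mulmxA (Phi t *m P0)) K1 mulmx1.
  by rewrite -(mulmxA (Phi t) (Psi s)) K1 mulmx1.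
have rate0 : 0 < rate by rewrite divr_gt0// mulr_gt0.
exists (cst * D + 1), rate; split=> //.
  by rewrite ltr_wpDl// mulr_ge0// sqrtr_ge0.
have fin t s (A : 'M[R]_m) (f : 'cV[R]_m -> R) : 0 <= s -> s <= t ->
    (forall x, f x <= D * enorm x) ->
    (forall x, enorm (A *m x) <= cst * expR (- rate * (t - s)) * f x) ->
    opnorm A <= (cst * D + 1) * expR (- rate * (t - s)).
  move=> s0 st fD Af; have e0 := expR_ge0 (- rate * (t - s)).
  apply: opnorm_le => [x|]; last by rewrite mulr_ge0// addr_ge0// mulr_ge0// sqrtr_ge0.
  apply: le_trans (Af x) _.
  apply: le_trans (ler_wpM2l _ (fD x)) _; first by rewrite mulr_ge0// sqrtr_ge0.
  rewrite mulrA ler_wpM2r ?enorm_ge0// mulrAC mulrDl mul1r lerDl//.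
move=> t s s0 st; split.
  apply: (fin t s _ (fun x => enorm (P s *m x)) s0 st) => x.
    by case: (bounds s x s0).
  have -> : Phi t *m Psi s *m P s *m x = Phi t *m (P0 *m (Psi s *m x)).
    by rewrite /P !mulmxA -(mulmxA (Phi t) (Psi s)) K1 mulmx1.
  have -> : P s *m x = Phi s *m (P0 *m (Psi s *m x)) by rewrite /P !mulmxA.
  exact: bounded_decay.
have t0 := le_trans s0 st.
apply: (fin t s _ (fun x => enorm ((1%:M - P t) *m x)) s0 st) => x.
  by case: (bounds t x t0).
rewrite (invmx_fund pair) compl.
have -> : Phi s *m Psi t *m (Phi t *m (1%:M - P0) *m Psi t) *m x =
    Phi s *m ((1%:M - P0) *m (Psi t *m x)).
  by rewrite !mulmxA -(mulmxA (Phi s) (Psi t)) K1 mulmx1.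
have -> : Phi t *m (1%:M - P0) *m Psi t *m x = Phi t *m ((1%:M - P0) *m (Psi t *m x)).
  by rewrite !mulmxA.
exact: kernel_growth.
Qed.

End LyapunovDichotomy.

(** * Concentration of the degrees *)

Lemma weights_antitone (R : realType) (n : nat) (u : nat -> R) j k :
  admissible_weights n u -> (1 <= j)%N -> (j <= k <= n)%N -> u k <= u j.
Proof.
move=> adm j1 /andP[]; elim: k => [|k IH]; first by case: j j1.
rewrite leq_eqVlt => /orP[/eqP -> //|jk] kn.
apply: le_trans (IH jk (ltnW kn)).
by apply: (weights_noninc adm); rewrite kn (leq_trans j1 jk).
Qed.

Section GraphProbability.
Context (R : realType) (n : nat) (u : nat -> R) (adm : admissible_weights n u).

Let upper (ij : 'I_n * 'I_n) := (ij.1 <= ij.2)%N.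

Lemma weight_gt0 (i : 'I_n) : 0 < u i.+1.
Proof. by apply: (weights_gt0 adm); rewrite /= ltn_ord. Qed.

Lemma weight_le_wmax (i : 'I_n) : u i.+1 <= wmax n u.
Proof.
rewrite /wmax big_add1 /= big_mkord.
exact: (@le_bigmax _ _ _ 0 (fun i : 'I_n => u i.+1)).
Qed.

Lemma wsumE : wsum n u = \sum_(i < n) u i.+1.
Proof. by rewrite /wsum big_add1 /= big_mkord. Qed.

Lemma edge_prob_ge0 (i j : 'I_n) : 0 <= edge_prob u i j.
Proof.
apply: divr_ge0; first by apply: mulr_ge0; exact: ltW (weight_gt0 _).
by rewrite wsumE sumr_ge0// => k _; exact: ltW (weight_gt0 k).
Qed.

Lemma wsum_gt0 (i : 'I_n) : 0 < wsum n u.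
Proof.
rewrite wsumE (bigD1 i)//= ltr_wpDr ?weight_gt0//.
by rewrite sumr_ge0// => k _; exact: ltW (weight_gt0 k).
Qed.

Lemma edge_prob_le1 (i j : 'I_n) : edge_prob u i j <= 1.
Proof.
rewrite /edge_prob ler_pdivrMr ?mul1r; last exact: wsum_gt0.
apply: le_trans (weights_max_sqr adm); rewrite expr2.
by rewrite ler_pM ?weight_le_wmax// ltW// weight_gt0.
Qed.

Lemma sum_edge_prob (i : 'I_n) : \sum_j edge_prob u i j = u i.+1.
Proof.
rewrite /edge_prob -mulr_suml -mulr_sumr -wsumE mulfK//.
by rewrite gt_eqF// (wsum_gt0 i).
Qed.

Lemma graph_mass_ge0 (A : 'M[bool]_n) : 0 <= graph_mass u A.
Proof.
apply: prodr_ge0 => ij _; case: ifP => _; first exact: edge_prob_ge0.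
by rewrite subr_ge0 edge_prob_le1.
Qed.

(** A symmetric matrix is freely determined by its entries on and above the
    diagonal, so a sum over graphs of a product over edges factorises. *)
Lemma sum_graphs_prod (F : 'I_n * 'I_n -> bool -> R) :
  \sum_(A : 'M[bool]_n | A^T == A) \prod_(ij | upper ij) F ij (A ij.1 ij.2) =
  \prod_(ij | upper ij) (F ij true + F ij false).
Proof.
have -> : \prod_(ij | upper ij) (F ij true + F ij false) =
    \prod_(ij | upper ij) \sum_(b : bool) F ij b.
  by apply: eq_bigr => ij _; rewrite big_bool.
rewrite (big_distr_big false)/=.
pose toG (f : {ffun 'I_n * 'I_n -> bool}) : 'M[bool]_n :=
  \matrix_(i, j) if (i <= j)%N then f (i, j) else f (j, i).
pose ofG (A : 'M[bool]_n) : {ffun 'I_n * 'I_n -> bool} :=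
  [ffun ij => upper ij && A ij.1 ij.2].
rewrite (reindex_onto toG ofG) /=.
  apply: eq_big => [f|f _].
    apply/andP/pffun_onP => [[_ /eqP fE]|[fs _]].
      split=> //; apply/fintype.subsetP => ij; rewrite inE -fE ffunE -topredE /=.
      by case: (upper ij).
    split.
      apply/eqP/matrixP => i j; rewrite !mxE.
      by case: (ltngtP i j) => // /val_inj ->.
    apply/eqP/ffunP => -[i j]; rewrite ffunE mxE /upper/=.
    case: leqP => // ij /=; apply/esym/negbTE/negP => fij.
    have := fintype.subsetP fs (i, j); rewrite inE fij => /(_ isT).
    by rewrite -topredE /upper /= leqNgt ij.
  apply: eq_bigr => -[i j]; rewrite /upper /= => ij.
  by rewrite mxE ij.
move=> A /eqP AT; apply/matrixP => i j; rewrite mxE !ffunE /upper /=.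
case: leqP => // ji; rewrite (ltnW ji) /=.
by rewrite -[in RHS]AT mxE.
Qed.

Lemma graph_mass_total : \sum_(A : 'M[bool]_n | A^T == A) graph_mass u A = 1.
Proof.
rewrite (sum_graphs_prod (fun ij (b : bool) =>
  if b then edge_prob u ij.1 ij.2 else 1 - edge_prob u ij.1 ij.2)).
by rewrite big1// => ij _; rewrite addrC subrK.
Qed.

Let incident (i : 'I_n) (ij : 'I_n * 'I_n) := (ij.1 == i) || (ij.2 == i).

(** The edges at the node [i], loop included, are in bijection with the nodes
    [j], through the ordered pair that represents the edge between [i] and [j]. *)
Lemma sum_incident (i : 'I_n) (G : 'I_n -> 'I_n -> R) :
  (forall j k, G j k = G k j) ->
  \sum_j G i j = \sum_(jk | upper jk && incident i jk) G jk.1 jk.2.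
Proof.
move=> Gsym.
pose h (j : 'I_n) := if (i <= j)%N then (i, j) else (j, i).
pose g (jk : 'I_n * 'I_n) := if jk.1 == i then jk.2 else jk.1.
rewrite [RHS](reindex_onto h g) /=; last first.
  move=> [j k]; rewrite /upper /incident /h /g /= => /andP[].
  case: (eqVneq j i) => [->|ji] jk /=; first by rewrite jk.
  move=> /eqP ki; rewrite ki in jk *; case: leqP => // ij.
  by move: ji; rewrite -val_eqE /= eqn_leq jk ij.
apply: eq_big => [j|j _]; rewrite /h /g /upper /incident.
  case: (leqP i j) => [ij|ji] /=; first by rewrite ?eqxx ?ij ?eqxx.
  by rewrite (ltnW ji) eqxx orbT /=; case: (eqVneq j i) => [->|_]; rewrite eqxx.
by case: (leqP i j).
Qed.

(** Exponential Markov inequality for both tails at once: [lam] may have either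
    sign. The moment generating function factorises over the edges, and each
    factor [1 + p * (expR lam - 1)] is at most [expR (p * (expR lam - 1))]. *)
Lemma chernoff (i : 'I_n) (lam a : R) :
  graph_prob u (fun A => lam * a <= lam * degree A i) <=
    expR (u i.+1 * (expR lam - 1) - lam * a).
Proof.
pose F (jk : 'I_n * 'I_n) (b : bool) : R :=
  (if b then edge_prob u jk.1 jk.2 else 1 - edge_prob u jk.1 jk.2) *
  (if incident i jk then expR (lam * b%:R) else 1).
have massE (A : 'M[bool]_n) : A^T == A ->
    graph_mass u A * expR (lam * degree A i) =
    \prod_(jk | upper jk) F jk (A jk.1 jk.2).
  move=> /eqP AT; rewrite /F big_split /=; congr (_ * _).
  rewrite -big_mkcondr /= /degree (@sum_incident i (fun j k => (A j k)%:R)).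
    by rewrite mulr_sumr expR_sum.
  by move=> j k; rewrite -[in LHS]AT mxE.
apply: (@le_trans _ _ (\sum_(A : 'M[bool]_n | A^T == A)
    expR (- (lam * a)) * (graph_mass u A * expR (lam * degree A i)))).
  rewrite /graph_prob big_mkcondr /=; apply: ler_sum => A _.
  case: asboolP => [h|_]; last first.
    by rewrite mulr_ge0 ?mulr_ge0 ?expR_ge0 ?graph_mass_ge0.
  rewrite mulrCA ler_peMr ?graph_mass_ge0// -expRD.
  by rewrite -[leLHS]expR0 ler_expR addrC subr_ge0.
rewrite -mulr_sumr addrC expRD ler_pM2l ?expR_gt0//.
rewrite (eq_bigr _ massE) (sum_graphs_prod F).
apply: (@le_trans _ _ (\prod_(jk | upper jk)
    expR (if incident i jk then edge_prob u jk.1 jk.2 * (expR lam - 1) else 0))).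
  apply: ler_prod => jk _; rewrite /F mulr1 mulr0 expR0.
  case: ifP => _; last by rewrite !mulr1 addrC subrK expR0 ler01 lexx.
  apply/andP; split.
    by apply: addr_ge0; apply: mulr_ge0;
      rewrite ?expR_ge0 ?edge_prob_ge0 ?subr_ge0 ?edge_prob_le1.
  apply: le_trans (expR_ge1Dx _); lra.
rewrite -expR_sum ler_expR -big_mkcondr /= -mulr_suml.
rewrite -(@sum_incident i (fun j k => edge_prob u j k)) ?sum_edge_prob//.
by move=> j k; rewrite /edge_prob [X in X / _]mulrC.
Qed.

Lemma graph_prob_union (E : 'M[bool]_n -> Prop) (bad : 'I_n -> 'M[bool]_n -> Prop)
    (p : R) :
  (forall i, graph_prob u (bad i) <= p) ->
  (forall A, A^T = A -> (forall i, ~ bad i A) -> E A) ->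
  1 - n%:R * p <= graph_prob u E.
Proof.
move=> badp EA; rewrite lerBlDr -[leLHS]graph_mass_total.
apply: (@le_trans _ _ (graph_prob u E + \sum_(i < n) graph_prob u (bad i))).
  rewrite /graph_prob (exchange_big_dep (fun A : 'M[bool]_n => A^T == A)) /=; last first.
    by move=> i A _ /andP[].
  rewrite big_mkcondr /= -big_split /=; apply: ler_sum => A AT.
  case: asboolP => [_|nE].
    by rewrite lerDl sumr_ge0// => i _; exact: graph_mass_ge0.
  have [i badi] : exists i, bad i A.
    apply: contrapT => nb; apply: nE; apply: EA; first exact/eqP.
    by move=> i bi; apply: nb; exists i.
  rewrite add0r (bigD1 i) /=; last by rewrite AT; apply/asboolP.
  by rewrite lerDl sumr_ge0// => j _; exact: graph_mass_ge0.
rewrite lerD2l; apply: (@le_trans _ _ (\sum_(i < n) p)); first exact: ler_sum.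
by rewrite sumr_const card_ord mulr_natl.
Qed.

Lemma degree_upper_tail (i : 'I_n) :
  graph_prob u (fun A => 4 * u i.+1 <= degree A i) <= expR (- (u i.+1 / 4)).
Proof.
rewrite (_ : (fun A => _ : Prop) =
  (fun A => 1 * (4 * u i.+1) <= 1 * degree A i :> R)); last first.
  by apply/funext => A; rewrite !mul1r.
apply: le_trans (chernoff i 1 _) _; rewrite ler_expR mul1r.
have := weight_gt0 i; have : expR 1 <= 4 :> R.
  have h2 : expR (1 / 2) <= 2 :> R.
    have := expR_ge1Dx (- (1 / 2) : R); rewrite expRN => h2.
    rewrite -[leLHS]invrK -[leRHS]invrK lef_pV2 ?posrE ?invr_gt0 ?expR_gt0//; lra.
  rewrite [X in expR X](_ : 1 = 1 / 2 + 1 / 2 :> R); last by lra.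
  have -> : 4 = 2 * 2 :> R by ring.
  by rewrite expRD ler_pM ?expR_ge0.
set w := u i.+1 => e1 w0.
have : w * expR 1 <= w * 4 by rewrite ler_pM2l.
lra.
Qed.

Lemma degree_lower_tail (i : 'I_n) :
  graph_prob u (fun A => degree A i <= u i.+1 / 4) <= expR (- (u i.+1 / 4)).
Proof.
rewrite (_ : (fun A => _ : Prop) =
  (fun A => - 1 * (u i.+1 / 4) <= - 1 * degree A i :> R)); last first.
  by apply/funext => A; rewrite !mulN1r lerN2.
apply: le_trans (chernoff i (- 1) _) _; rewrite ler_expR mulN1r.
have := weight_gt0 i; have : expR (- 1) <= 1 / 2 :> R.
  rewrite expRN div1r lef_pV2 ?posrE ?expR_gt0//.
  by apply: le_trans (expR_ge1Dx 1); lra.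
set w := u i.+1 => e1 w0.
have : w * expR (- 1) <= w * (1 / 2) by rewrite ler_pM2l.
lra.
Qed.

End GraphProbability.

(** * Asymptotics of strongly heterogeneous weights *)

Lemma powR_unbounded (R : realType) (r K : R) : 0 < r ->
  exists X, forall x, X <= x -> K <= x `^ r.
Proof.
move=> r0; exists (Num.max K 1 `^ r^-1) => x Xx.
have K1 : 0 <= Num.max K 1 by rewrite le_max ler01 orbT.
apply: (@le_trans _ _ (Num.max K 1)); first by rewrite le_max lexx.
have -> : Num.max K 1 = (Num.max K 1 `^ r^-1) `^ r.
  by rewrite -powRrM mulVf ?powRr1// gt_eqF.
have x0 : 0 <= x by exact: le_trans (powR_ge0 _ _) Xx.
by apply: ge0_ler_powR; rewrite ?nnegrE ?powR_ge0// ltW.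
Qed.

Lemma near_ln_ge (R : realType) (K : R) : \forall n \near \oo, K <= ln (n%:R : R).
Proof.
exists (Num.truncn (expR K)).+1 => // n /= Kn.
rewrite -[leLHS]expRK ler_ln ?posrE ?expR_gt0//; last by rewrite ltr0n; case: n Kn.
by apply: le_trans (ltW (truncnS_gt _)) _; rewrite ler_nat.
Qed.

Lemma near_gt_limn_einf (R : realType) (f : nat -> R) (c l : R) :
  limn_einf (fun n => (f n)%:E) = l%:E -> c < l -> \forall n \near \oo, c < f n.
Proof.
rewrite limn_einf_lim (cvg_lim _ (@cvg_einfs_sup R _))// => fl cl.
have : (c%:E < ereal_sup (range (einfs (fun n => (f n)%:E))))%E by rewrite fl lte_fin.
move=> /ereal_sup_gt[_ [N _ <-] cN]; exists N => // n Nn /=.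
rewrite -lte_fin; apply: lt_le_trans cN _.
by apply: ereal_inf_lbound; exists n.
Qed.

Section Regime.
Context (R : realType) (theta gamma : R) (ell : nat -> nat) (w : nat -> nat -> R)
  (theta1 : 0 < theta < 1) (gamma1 : 0 < gamma < 1)
  (sh : strongly_heterogeneous ell theta gamma w).

Let D n := wmax n (w n).
Let L n : R := ln n%:R.

Lemma near_hub_weights : exists2 c0, 0 < c0 &
  \forall n \near \oo, c0 < w n (ell n) / D n.
Proof.
have [c0 [/andP[c00 _] lim]] := large_hubs sh.
by exists c0 => //; apply: (near_gt_limn_einf lim); lra.
Qed.

Let le_wmax n k : (1 <= k <= n)%N -> w n k <= D n.
Proof.
case: k => // k /= kn; rewrite /D /wmax big_add1 /= big_mkord.
exact: (@le_bigmax _ _ _ 0 (fun i : 'I_n => w n i.+1) (Ordinal kn)).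
Qed.

Let min_weight n k : (1 <= k <= n)%N -> w n n <= w n k.
Proof.
move=> /andP[k1 kn]; have n1 := leq_trans k1 kn.
by apply: (weights_antitone (ensembles_admissible sh n1) k1); rewrite kn leqnn.
Qed.

Lemma wmax_gt0 n : (1 <= n)%N -> 0 < D n.
Proof.
move=> n1; apply: lt_le_trans (le_wmax (_ : 1 <= n <= n)%N); last by rewrite n1 leqnn.
by apply: (weights_gt0 (ensembles_admissible sh n1)); rewrite n1 leqnn.
Qed.

Let wmax_le n : (1 <= n)%N -> D n <= n%:R.
Proof.
move=> n1; rewrite -(ler_pM2r (wmax_gt0 n1)) -expr2.
apply: le_trans (weights_max_sqr (ensembles_admissible sh n1)) _.
rewrite /wsum big_add1 /= big_mkord; apply: (@le_trans _ _ (\sum_(i < n) D n)).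
  by apply: ler_sum => i _; apply: le_wmax; rewrite /= ltn_ord.
by rewrite sumr_const card_ord mulr_natl.
Qed.

(** From [D n ^+ 2 <= wsum n (w n) <= n * D n] one gets [D n <= n], so the number of
    hubs is of order at most [n `^ theta]. *)
Lemma near_ell_lt : \forall n \near \oo, (ell n < n)%N.
Proof.
have [G [G0 Gell]] := few_hubs sh.
have /andP[th0 th1] := theta1; have th : 0 < 1 - theta by lra.
have [X XP] := powR_unbounded G th.
near=> n.
have n1 : (1 <= n)%N by near: n; exists 1%N.
have Xn : X <= n%:R.
  near: n; exists (Num.truncn X).+1 => // k /= Xk.
  by apply: le_trans (ltW (truncnS_gt _)) _; rewrite ler_nat.
rewrite -(ltr_nat R); apply: lt_le_trans (Gell n n1) _.
apply: (@le_trans _ _ (n%:R `^ (1 - theta) * n%:R `^ theta)).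
  apply: ler_pM; rewrite ?powR_ge0 ?XP ?(ltW G0)//.
  by apply: ge0_ler_powR; rewrite ?nnegrE ?wmax_le ?(ltW (wmax_gt0 n1))//; lra.
by rewrite -powRD ?subrK ?powRr1// pnatr_eq0 -lt0n n1 implybT.
Unshelve. all: by end_near. Qed.

(** There are low-degree nodes, the last one in particular, and its weight beats
    [ln n] by the factor [ln n `^ beta]. *)
Lemma near_min_weight (K : R) : \forall n \near \oo, K * L n <= w n n.
Proof.
have [G1 [G2 [beta [G10 G20 beta0 low]]]] := low_degree_nodes sh.
have [X XP] := powR_unbounded (K / G1) beta0.
near=> n.
have n1 : (1 <= n)%N by near: n; exists 1%N.
have elln : (ell n < n)%N by near: n; exact: near_ell_lt.
have Ln1 : 1 <= L n by near: n; exact: near_ln_ge.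
have XL : X <= L n by near: n; exact: near_ln_ge.
have /andP[/ltW h _] := low n n n1 (introT andP (conj elln (leqnn n))).
apply: le_trans h; have L0 : L n != 0 by rewrite gt_eqF// (lt_le_trans ltr01).
rewrite -/(L n) powRD ?L0 ?implybT// powRr1 ?(le_trans ler01)// mulrCA mulrC.
rewrite ler_pM2l ?(lt_le_trans ltr01)//.
by rewrite -ler_pdivrMl// mulrC; exact: XP.
Unshelve. all: by end_near. Qed.

Lemma near_weight_ge (K : R) : \forall n \near \oo,
  forall k, (1 <= k <= n)%N -> K * L n <= w n k.
Proof.
have := near_min_weight K; apply: filterS => n h k kn.
exact: le_trans h (min_weight kn).
Qed.

Lemma near_wmax_ge (K : R) : \forall n \near \oo, K * L n <= D n.
Proof.
near=> n; have n1 : (1 <= n)%N by near: n; exists 1%N.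
apply: (@le_trans _ _ (w n n)); first by near: n; exact: near_min_weight.
by apply: le_wmax; rewrite n1 leqnn.
Unshelve. all: by end_near. Qed.

Lemma near_ell_small (K : R) : \forall n \near \oo, K * (ell n)%:R <= D n.
Proof.
have [G [G0 Gell]] := few_hubs sh.
have /andP[th0 th1] := theta1; have th : 0 < 1 - theta by lra.
have [X XP] := powR_unbounded (`|K| * G) th.
near=> n.
have n1 : (1 <= n)%N by near: n; exists 1%N.
have D0 := wmax_gt0 n1.
have XD : X <= D n.
  apply: (@le_trans _ _ (1 * L n)); last by near: n; exact: near_wmax_ge.
  by rewrite mul1r; near: n; exact: near_ln_ge.
apply: (@le_trans _ _ (`|K| * (ell n)%:R)); first by rewrite ler_wpM2r// ler_norm.
apply: (@le_trans _ _ (`|K| * (G * D n `^ theta))).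
  by rewrite ler_wpM2l// ltW// Gell.
rewrite mulrA; apply: (@le_trans _ _ (D n `^ (1 - theta) * D n `^ theta)).
  by rewrite ler_wpM2r ?powR_ge0 ?XP.
by rewrite -powRD ?subrK ?powRr1// ?(ltW D0)// gt_eqF// implybT.
Unshelve. all: by end_near. Qed.

(** Since [w n k] is of order at most [D n `^ (1 - gamma)], the quotient by [D n] is
    bounded by a multiple of [(L n / D n) `^ gamma], which tends to [0]. *)
Lemma near_low_weight (K : R) : \forall n \near \oo,
  forall k, (ell n < k <= n)%N -> K * (L n `^ gamma * w n k) <= D n.
Proof.
have [G1 [G2 [beta [G10 G20 beta0 low]]]] := low_degree_nodes sh.
have /andP[g0 g1] := gamma1.
have [X XP] := powR_unbounded (`|K| * G2) g0.
near=> n => k kn.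
have n1 : (1 <= n)%N by near: n; exists 1%N.
have D0 := wmax_gt0 n1.
have Ln1 : 1 <= L n by near: n; exact: near_ln_ge.
have /andP[_ /ltW h] := low n k n1 kn.
have wk0 : 0 < w n k.
  apply: (weights_gt0 (ensembles_admissible sh n1)).
  by case/andP: kn => ? ->; rewrite andbT (leq_trans _ (_ : ell n < k)%N).
have XL : Num.max X 1 * L n <= D n by near: n; exact: near_wmax_ge.
have X0 : 0 <= Num.max X 1 by rewrite le_max ler01 orbT.
have L0 : 0 <= L n by exact: le_trans Ln1.
apply: (@le_trans _ _ (`|K| * (L n `^ gamma * w n k))).
  by rewrite ler_wpM2r ?ler_norm// mulr_ge0 ?powR_ge0// ltW.
apply: (@le_trans _ _ (`|K| * (L n `^ gamma * (G2 * D n `^ (1 - gamma))))).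
  by rewrite !ler_wpM2l ?powR_ge0.
have DD : D n `^ gamma * D n `^ (1 - gamma) = D n.
  by rewrite -powRD addrC ?subrK ?powRr1// ?(ltW D0)// gt_eqF// implybT.
rewrite -[leRHS]DD !mulrA ler_wpM2r ?powR_ge0//.
have : (Num.max X 1 * L n) `^ gamma <= D n `^ gamma.
  by apply: ge0_ler_powR; rewrite ?nnegrE ?(ltW D0) ?mulr_ge0//; exact: ltW.
apply: le_trans; rewrite powRM// mulrAC ler_wpM2r ?powR_ge0//.
by apply: XP; rewrite le_max lexx.
Unshelve. all: by end_near. Qed.

Lemma near_regime : exists2 c0, 0 < c0 & forall K1 K2 K3 : R, \forall n \near \oo,
  [/\ (ell n < n)%N, c0 < w n (ell n) / D n,
      forall k, (1 <= k <= n)%N -> K1 * L n <= w n k,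
      K2 * (ell n)%:R <= D n &
      forall k, (ell n < k <= n)%N -> K3 * (L n `^ gamma * w n k) <= D n].
Proof.
have [c0 c00 hub] := near_hub_weights; exists c0 => // K1 K2 K3.
near=> n; split.
- by near: n; exact: near_ell_lt.
- by near: n; exact: hub.
- by near: n; exact: near_weight_ge.
- by near: n; exact: near_ell_small.
- by near: n; exact: near_low_weight.
Unshelve. all: by end_near. Qed.

End Regime.

(** * Block vectors and block diagonal matrices *)

Definition blk (R : realType) (n d : nat) (i : 'I_n) (X : 'cV[R]_(n * d)) : 'cV[R]_d :=
  \col_k X (mxtens_index (i, k)) 0.

Definition bdiag (R : realType) (n d : nat) (F : 'I_n -> 'M[R]_d) : 'M[R]_(n * d) :=
  \sum_i (delta_mx i i *t F i).

Lemma sum_mxtens (R : realType) (n d : nat) (f : 'I_(n * d) -> R) :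
  \sum_k f k = \sum_i \sum_j f (mxtens_index (i, j)).
Proof.
rewrite pair_bigA /= (reindex (@mxtens_index n d)) /=.
  by apply: eq_bigr => -[].
exists (@mxtens_unindex n d) => x _; [exact: mxtens_indexK|exact: mxtens_unindexK].
Qed.

Lemma bdiagE (R : realType) (n d : nat) (F : 'I_n -> 'M[R]_d) i j k l :
  bdiag F (mxtens_index (i, k)) (mxtens_index (j, l)) = (i == j)%:R * F i k l.
Proof.
rewrite summxE (bigD1 i) //= big1 ?addr0 => [|p pi].
  by rewrite tensmxE mxE eqxx eq_sym.
by rewrite tensmxE mxE eq_sym (negbTE pi) mul0r.
Qed.

Lemma blk_tens (R : realType) (n d : nat) (A : 'M[R]_n) (G : 'M[R]_d) i X :
  blk i ((A *t G) *m X) = \sum_j A i j *: (G *m blk j X).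
Proof.
apply/colP => k; rewrite summxE !mxE sum_mxtens; apply: eq_bigr => j _.
rewrite !mxE mulr_sumr; apply: eq_bigr => l _.
by rewrite tensmxE !mxE mulrA.
Qed.

Lemma blk_bdiag (R : realType) (n d : nat) (F : 'I_n -> 'M[R]_d) i X :
  blk i (bdiag F *m X) = F i *m blk i X.
Proof.
apply/colP => k; rewrite !mxE sum_mxtens (bigD1 i) //= [X in _ + X]big1 ?addr0.
  by apply: eq_bigr => l _; rewrite bdiagE eqxx mul1r mxE.
move=> j ji; apply: big1 => l _.
by rewrite bdiagE eq_sym (negbTE ji) !mul0r.
Qed.

Lemma blkD (R : realType) (n d : nat) (i : 'I_n) (X Y : 'cV[R]_(n * d)) :
  blk i (X + Y) = blk i X + blk i Y.
Proof. by apply/colP => k; rewrite !mxE. Qed.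

Lemma blkB (R : realType) (n d : nat) (i : 'I_n) (X Y : 'cV[R]_(n * d)) :
  blk i (X - Y) = blk i X - blk i Y.
Proof. by apply/colP => k; rewrite !mxE. Qed.

Lemma blkZ (R : realType) (n d : nat) (i : 'I_n) a (X : 'cV[R]_(n * d)) :
  blk i (a *: X) = a *: blk i X.
Proof. by apply/colP => k; rewrite !mxE. Qed.

Lemma dot_blk (R : realType) (n d : nat) (X Y : 'cV[R]_(n * d)) :
  dot X Y = \sum_i dot (blk i X) (blk i Y).
Proof.
rewrite dotE sum_mxtens; apply: eq_bigr => i _.
by rewrite dotE; apply: eq_bigr => k _; rewrite !mxE.
Qed.

Lemma is_derive_bdiag (R : realType) (n d : nat) (F : 'I_n -> R -> 'M[R]_d)
    (dF : 'I_n -> 'M[R]_d) (t : R) :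
  (forall i, is_derive t 1 (F i) (dF i)) ->
  is_derive t 1 (fun s => bdiag (fun i => F i s)) (bdiag dF).
Proof.
move=> Fd; apply/is_derive_mxP => a b.
case: (mxtens_indexP a) => i k; case: (mxtens_indexP b) => j l.
rewrite bdiagE (_ : (fun s => _) = (fun s => (i == j)%:R * F i s k l)).
  by apply: is_derive_scale; have /is_derive_mxP := Fd i; exact.
by apply/funext => s; rewrite bdiagE.
Qed.

(** The first [l] nodes occupy the first [l * d] coordinates; the rank of the right
    hand side is known. *)
Lemma bdiag_pid (R : realType) (n d l : nat) :
  bdiag (fun i : 'I_n => (i < l)%:R%:M) = pid_mx (l * d) :> 'M[R]_(n * d).
Proof.
apply/matrixP => a b; case: (mxtens_indexP a) => i k; case: (mxtens_indexP b) => j m.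
rewrite bdiagE !mxE -!val_eqE /=.
have -> : (i * d + k < l * d)%N = (i < l)%N.
  have d0 : (0 < d)%N by apply: leq_ltn_trans (ltn_ord k).
  by rewrite -ltn_divLR// divnMDl// divn_small ?addn0// ltn_ord.
have -> : (i * d + k == j * d + m)%N = (i == j) && (k == m).
  have := inj_eq (can_inj (@mxtens_indexK n d)) (i, k) (j, m).
  by rewrite -val_eqE /= xpair_eqE => ->.
by rewrite -!val_eqE /=; case: eqP; case: eqP; case: leqP;
  rewrite ?mul0r ?mulr0 ?mul1r ?mulr1n ?mulr0n.
Qed.

(** A block diagonal form is bounded by the largest bound of its blocks, by
    Cauchy-Schwarz for the vectors of block norms. *)
Lemma enorm_bdiag_le (R : realType) (n d : nat) (F : 'I_n -> 'M[R]_d) (b : R) X Y :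
  0 <= b -> (forall i x y, `|dot x (F i *m y)| <= b * (enorm x * enorm y)) ->
  `|dot X (bdiag F *m Y)| <= b * (enorm X * enorm Y).
Proof.
move=> b0 Fb; rewrite dot_blk; apply: le_trans (ler_norm_sum _ _ _) _.
pose v (Z : 'cV[R]_(n * d)) : 'cV[R]_n := \col_i enorm (blk i Z).
have vE Z : enorm (v Z) = enorm Z.
  rewrite [RHS]enormE enormE dot_blk dotE; congr Num.sqrt.
  by apply: eq_bigr => i _; rewrite mxE -expr2 enorm_sqr.
apply: (@le_trans _ _ (b * dot (v X) (v Y))); last first.
  rewrite ler_wpM2l// -!vE; apply: le_trans (cauchy_schwarz _ _); exact: ler_norm.
rewrite dotE mulr_sumr; apply: ler_sum => i _.
by rewrite blk_bdiag !mxE.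
Qed.

(** * Lyapunov functions of the unstable nodes *)

Lemma bounded_family_opnorm (R : realType) (d : nat) (V : nat -> R -> 'M[R]_d) :
  bounded_continuous_family V -> exists2 M, 0 <= M &
    forall i t, (1 <= i)%N -> 0 < t -> opnorm (V i t) <= M.
Proof.
move=> [_ _ VM]; move: VM; set S := ereal_sup _ => SM.
have le i t : (1 <= i)%N -> 0 < t -> ((opnorm (V i t))%:E <= S)%E.
  move=> i1 t0; apply: (@le_trans _ _ (supnorm (V i))).
    by apply: ereal_sup_ubound; exists t.
  by apply: ereal_sup_ubound; exists i.
exists (Num.max 0 (fine S)) => [|i t i1 t0]; first by rewrite le_max lexx.
have Sfin : S \is a fin_num.
  rewrite fin_numElt SM andbT; apply: lt_le_trans (le 1%N 1 _ _) => //.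
  exact: ltNyr.
by have := le i t i1 t0; rewrite -(fineK Sfin) lee_fin le_max => ->; rewrite orbT.
Qed.

Lemma entry_continuous (R : realType) (d : nat) (V : R -> 'M[R]_d) :
  continuous V -> forall i j, continuous (fun t => V t i j).
Proof.
move=> Vc i j t; apply: (@continuous_comp _ _ _ V (fun M : 'M[R]_d => M i j)).
  exact: Vc.
exact: coord_continuous.
Qed.

(** The Lyapunov function of an unstable node. Up to a term for the initial value,
    [dot x (N t *m x)] is the integral over [s] in [0, t] of the squared norm of
    the solution that passes through [x] at time [t]. Backwards in time solutions
    decay exponentially, so this is bounded uniformly in [t], and it grows along
    solutions at the rate [dot x x]. *)
Lemma unstable_node_form (R : realType) (d : nat) (V : R -> 'M[R]_d) T (b K0 eta0 : R) :
  continuous V -> (forall t, opnorm (V t) <= b) -> evolution_operator V T ->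
  0 < eta0 -> 0 < K0 ->
  (forall t s, s < t -> opnorm (invmx (T t s)) <= K0 * expR (- eta0 * (t - s))) ->
  exists N : R -> 'M[R]_d,
    [/\ forall t : R, is_derive t 1 N (1%:M - (V t)^T *m N t - N t *m V t),
        N 0 = 1%:M &
        forall t x y, 0 <= t ->
          `|dot x (N t *m y)| <= (1 + K0 ^+ 2 + K0 ^+ 2 / (2 * eta0)) *
            (enorm x * enorm y)].
Proof.
move=> Vc Vb VT eta0_gt0 K0_gt0 Tdecay.
have Vcij := entry_continuous Vc.
have Vbij t i j : `|V t i j| <= b by apply: le_trans (entry_le_opnorm _ _ _) (Vb t).
have [Phi [Psi pair]] := fundamental_pair_exists Vcij Vbij.
have TE := evolutionE pair VT.
have Phic i j : continuous (fun t => Phi t i j).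
  move=> t; have /is_derive_mxP/(_ i j) := fund_derive pair t.
  exact: is_derive_continuous.
have prim (ij : 'I_d * 'I_d) : exists F : R -> R,
    (forall x : R, is_derive x 1 F (((Phi x)^T *m Phi x) ij.1 ij.2)) /\ F 0 = 0.
  apply: primitive_exists; apply: continuous_mulmx_entry => // i j.
  by rewrite (_ : (fun t => _) = (fun t => Phi t j i))//; apply/funext => t; rewrite mxE.
have [f fP] := choice prim.
pose F t : 'M[R]_d := 1%:M + \matrix_(i, j) f (i, j) t.
have F0 : F 0 = 1%:M.
  by apply/matrixP => i j; rewrite !mxE (fP (i, j)).2 addr0.
have dF (t : R) : is_derive t 1 F ((Phi t)^T *m Phi t).
  apply/is_derive_mxP => i j; rewrite -[_ i j]add0r.
  rewrite (_ : (fun s => _) = (fun s => (i == j)%:R + f (i, j) s)).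
    by apply: is_derive_add; exact: (fP (i, j)).1.
  by apply/funext => s; rewrite !mxE.
pose N t := (Psi t)^T *m F t *m Psi t.
exists N; split=> [t||t x y t0].
- have dP := fund_inv_derive pair t.
  apply: (is_derive_eq (is_derive_mulmx (is_derive_mulmx (is_derive_trmx dP) (dF t)) dP)).
  rewrite mulmxDl.
  have -> : (- (Psi t *m V t))^T *m F t *m Psi t = - ((V t)^T *m N t).
    by rewrite linearN/= trmx_mul !mulNmx /N !mulmxA.
  have -> : (Psi t)^T *m ((Phi t)^T *m Phi t) *m Psi t = 1%:M.
    by rewrite -!mulmxA (fundKr pair) mulmx1 -trmx_mul (fundKr pair) trmx1.
  have -> : (Psi t)^T *m F t *m - (Psi t *m V t) = - (N t *m V t).
    by rewrite mulmxN /N !mulmxA.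
  by rewrite [- _ + 1%:M]addrC.
- by rewrite /N F0 (fund_inv0 pair) trmx1 !mulmx1.
have decay s z : s < t -> enorm (Phi s *m (Psi t *m z)) <=
    K0 * expR (- eta0 * (t - s)) * enorm z.
  move=> st; rewrite mulmxA -(invmx_fund pair) -TE.
  apply: le_trans (enorm_mulmx_le _ _) _.
  by rewrite ler_wpM2r ?enorm_ge0// Tdecay.
pose e := enorm x * enorm y; have e0 : 0 <= e by rewrite mulr_ge0 ?enorm_ge0.
pose q s := dot (Psi t *m x) (F s *m (Psi t *m y)).
have qt : q t = dot x (N t *m y) by rewrite /q dot_mull /N !mulmxA.
have dq (s : R) : is_derive s 1 q (dot (Phi s *m (Psi t *m x)) (Phi s *m (Psi t *m y))).
  have dc : is_derive s 1 (fun=> Psi t *m x) 0 by exact: is_derive_cst.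
  have d1 := is_derive_mulmx_const (Psi t *m y) (dF s).
  apply: (is_derive_eq (is_derive_dot dc d1)); rewrite [in RHS]dot_mull !mulmxA.
  by rewrite [X in X + _](_ : _ = 0) ?add0r// dotC dot0r.
have q0 : `|q 0| <= (1 + K0 ^+ 2) * e.
  rewrite /q F0 mul1mx; apply: le_trans (cauchy_schwarz _ _) _.
  have [->|tn0] := eqVneq t 0.
    rewrite (fund_inv0 pair) !mul1mx mulrDl mul1r -/e lerDl mulr_ge0// sqr_ge0//.
  have tgt0 : 0 < t by rewrite lt_neqAle eq_sym tn0.
  have K z : enorm (Psi t *m z) <= K0 * enorm z.
    have := decay 0 z tgt0; rewrite (fund0 pair) mul1mx subr0.
    move=> h; apply: le_trans h _; rewrite ler_wpM2r ?enorm_ge0//.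
    by rewrite ler_piMr ?(ltW K0_gt0)// -[leRHS]expR0 ler_expR mulNr oppr_le0 mulr_ge0// ltW.
  apply: (@le_trans _ _ (K0 * enorm x * (K0 * enorm y))).
    by rewrite ler_pM ?enorm_ge0.
  rewrite /e expr2; have := e0; rewrite /e => ee; lra.
pose h s := K0 ^+ 2 / (2 * eta0) * e * expR (2 * eta0 * (s - t)).
have dh (s : R) : is_derive s 1 h (K0 ^+ 2 * e * expR (2 * eta0 * (s - t))).
  have dl : is_derive s 1 (fun s => 2 * eta0 * (s - t)) (2 * eta0).
    have := is_derive_scale (2 * eta0)
      (is_derive_sub (is_derive_id s 1) (is_derive_const t s)).
    by rewrite subr0 mulr1.
  have -> : K0 ^+ 2 * e * expR (2 * eta0 * (s - t)) =
      K0 ^+ 2 / (2 * eta0) * e * (expR (2 * eta0 * (s - t)) * (2 * eta0)).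
    by field; rewrite gt_eqF.
  have dE := @is_derive1_comp _ expR (fun s => 2 * eta0 * (s - t)) _ _ _
    (is_derive_expR (2 * eta0 * (s - t))) dl.
  exact: is_derive_scale dE.
have qh s : s < t -> `|dot (Phi s *m (Psi t *m x)) (Phi s *m (Psi t *m y))| <=
    K0 ^+ 2 * e * expR (2 * eta0 * (s - t)).
  move=> st; apply: le_trans (cauchy_schwarz _ _) _.
  apply: le_trans (ler_pM (enorm_ge0 _) (enorm_ge0 _) (decay s x st) (decay s y st)) _.
  have -> : 2 * eta0 * (s - t) = - eta0 * (t - s) + - eta0 * (t - s) by ring.
  by rewrite expRD /e le_eqVlt; apply/orP; left; apply/eqP; ring.
have up : q t - h t <= q 0 - h 0.
  apply: (nonincreasing_of_derive (fun s _ => is_derive_sub (dq s) (dh s)) _ t0) => s.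
  move=> /andP[_ st]; rewrite subr_le0; apply: le_trans (qh s st); exact: ler_norm.
have dn : - q t - h t <= - q 0 - h 0.
  apply: (nonincreasing_of_derive
    (fun s _ => is_derive_sub (is_derive_opp (dq s)) (dh s)) _ t0) => s.
  move=> /andP[_ st]; rewrite subr_le0; apply: le_trans (qh s st).
  by rewrite -normrN; exact: ler_norm.
have ht : h t = K0 ^+ 2 / (2 * eta0) * e by rewrite /h subrr mulr0 expR0 mulr1.
have h0 : 0 <= h 0.
  rewrite /h mulr_ge0 ?expR_ge0// mulr_ge0// divr_ge0 ?sqr_ge0// mulr_ge0// ltW//.
rewrite -qt -/e mulrDl; rewrite ht in up dn.
move: q0; rewrite !ler_norml => /andP[? ?]; apply/andP; split; lra.
Qed.

(** * Coercivity and sums over edges *)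

(** Cauchy-Schwarz for the form of [H], applied to [x] and [H^-1 x], bounds
    [|x| ^ 4] by [dot x (H x) * dot x (H^-1 x)]; this gives the coercivity
    constant without a spectral theorem or a compactness argument. *)
Lemma posdef_coercive (R : realType) (d : nat) (H : 'M[R]_d) : posdefmx H ->
  exists2 h, 0 < h & forall x, h * dot x x <= dot x (H *m x).
Proof.
move=> [HT Hpos].
have Hp x : x != 0 -> 0 < dot x (H *m x) by move=> /Hpos; rewrite /dot mulmxA.
have Hge x : 0 <= dot x (H *m x).
  by have [->|/Hp/ltW//] := eqVneq x 0; rewrite mulmx0 dot0r.
have HC x y : dot x (H *m y) = dot y (H *m x).
  by rewrite -[in LHS]HT -dot_mull dotC.
have U : H \in unitmx.
  rewrite -row_free_unit -kermx_eq0; apply/eqP/row_matrixP => i.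
  rewrite row0; apply: trmx_inj; rewrite trmx0; set z := (row i _)^T.
  apply/eqP; apply: contraT => /Hp; rewrite (_ : H *m z = 0) ?dot0r ?ltxx//.
  apply: trmx_inj; rewrite trmx_mul trmxK HT trmx0.
  by apply/sub_kermxP; exact: row_sub.
pose G := invmx H; have [c c0 Gc] := mx_entries_bounded G.
pose g := d%:R * c + 1; have g0 : 0 < g by rewrite ltr_wpDl// mulr_ge0.
exists g^-1 => [|x]; first by rewrite invr_gt0.
rewrite ler_pdivrMl//; have [->|x0] := eqVneq x 0; first by rewrite !(mulmx0, dot0r) mulr0.
pose z := G *m x; have Hz : H *m z = x by rewrite /z mulKVmx.
have z0 : z != 0 by apply: contra_neq x0 => z0; rewrite -Hz z0 mulmx0.
have xx : dot x (H *m z) = dot x x by rewrite Hz.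
have p0 := Hp z z0; have xg : dot z (H *m z) <= g * dot x x.
  rewrite Hz -enorm_sqr; apply: le_trans (ler_norm _) _.
  apply: le_trans (cauchy_schwarz _ _) _.
  rewrite expr2 mulrA ler_wpM2r ?enorm_ge0//; apply: le_trans (enorm_mulmx_entries _ Gc) _.
  by rewrite ler_wpM2r ?enorm_ge0// lerDl.
have := Hge (dot z (H *m z) *: x - dot x x *: z).
rewrite mulmxBr -!scalemxAr !(dotDl, dotDr, dotNl, dotNr, dotZl, dotZr) (HC z x) xx.
set p := dot z (H *m z) in p0 xg *; set q := dot x (H *m x); set s := dot x x in xg *.
move=> h; have s0 : 0 < s by rewrite lt_neqAle dot_ge0 andbT eq_sym dot_eq0.
have h2 : 0 <= p * (p * q - s * s) by lra.
move: h2; rewrite pmulr_rge0// subr_ge0 => h2.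
rewrite -(ler_pM2l s0); apply: le_trans h2 _.
rewrite mulrA (mulrC s g); apply: ler_wpM2r => //; exact: Hge.
Qed.

(** Young's inequality on every edge, with weights that may depend on the
    orientation; by symmetry of the graph each edge is charged to both of its
    ends. *)
Lemma sum_edges_young (R : realType) (n : nat) (A : 'M[bool]_n) (a : 'I_n -> R)
    (r : 'I_n -> 'I_n -> R) : A^T = A ->
  (forall i j, 0 < r i j) -> (forall i j, r i j * r j i = 1) ->
  \sum_i \sum_j (A i j)%:R * (a i * a j) <=
  \sum_i a i ^+ 2 * \sum_j (A i j)%:R * r i j.
Proof.
move=> AT r0 r1.
have young i j : a i * a j <= (r i j * a i ^+ 2 + r j i * a j ^+ 2) / 2.
  have : 0 <= (r i j * a i - a j) ^+ 2 * r j i by rewrite mulr_ge0 ?sqr_ge0// ltW.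
  have -> : (r i j * a i - a j) ^+ 2 * r j i = r i j * a i ^+ 2 * (r i j * r j i) -
      2 * (a i * a j) * (r i j * r j i) + r j i * a j ^+ 2 by ring.
  by rewrite r1; lra.
apply: (@le_trans _ _ (\sum_i \sum_j ((A i j)%:R * (r i j * a i ^+ 2) / 2 +
                                      (A i j)%:R * (r j i * a j ^+ 2) / 2))).
  apply: ler_sum => i _; apply: ler_sum => j _.
  by have := ler_wpM2l (ler0n R (A i j)) (young i j); lra.
under eq_bigr do rewrite big_split /=.
rewrite big_split /= [X in _ + X]exchange_big /=.
rewrite [X in _ + X](eq_bigr (fun i =>
  \sum_j (A i j)%:R * (r i j * a i ^+ 2) / 2)); last first.
  by move=> i _; apply: eq_bigr => j _; rewrite -[in LHS]AT mxE.
rewrite -big_split /=; apply: ler_sum => i _; rewrite -big_split mulr_sumr /=.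
by apply: ler_sum => j _; rewrite le_eqVlt; apply/orP; left; apply/eqP; field.
Qed.

Lemma sum_ord_lt (R : realType) (n l : nat) : (l <= n)%N ->
  \sum_(j < n) (j < l)%:R = l%:R :> R.
Proof.
move=> ln; transitivity (\sum_(j < l) 1 : R); last by rewrite sumr_const card_ord.
rewrite (big_ord_widen n (fun=> 1))//.
rewrite [RHS]big_mkcond /=; by apply: eq_bigr => j _; case: (j < l)%N.
Qed.

(** * The Lyapunov form of the coupled equations *)

Section CoupledLyapunov.
Context (R : realType) (n d l : nat) (V : nat -> R -> 'M[R]_d) (H : 'M[R]_d)
  (alpha : R) (A : 'M[bool]_n) (N : nat -> R -> 'M[R]_d) (MV h h' b M : R).

Context (AT : A^T = A) (ln : (l <= n)%N) (alpha0 : 0 < alpha)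
  (h0 : 0 < h) (hh' : h <= h') (b1 : 1 <= b)
  (VM : forall i t, (1 <= i)%N -> 0 < t -> opnorm (V i t) <= MV)
  (Hlow : forall x, h * dot x x <= dot x (H *m x))
  (Hup : forall x, enorm (H *m x) <= h' * enorm x)
  (dN : forall i (t : R), (1 <= i)%N ->
    is_derive t 1 (N i) (1%:M - (V i t)^T *m N i t - N i t *m V i t))
  (N0 : forall i, (1 <= i)%N -> N i 0 = 1%:M)
  (Nb : forall i t x y, (1 <= i)%N -> 0 <= t ->
    `|dot x (N i t *m y)| <= b * (enorm x * enorm y))
  (BM : forall t x, 0 < t ->
    enorm (coupled_equations V H alpha A t *m x) <= M * enorm x).

(* [g] bounds the coupling along one edge. In Young's inequality a hub takes the
   share [eps] of its edges to low-degree nodes; as [g * eps = alpha * h], this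
   costs at most half of its damping [2 * alpha * h * degree A i]. *)
Let g := 2 * alpha * h' * b.
Let eps := h / (2 * h' * b).

Context
  (hub : forall i : 'I_n, (i < l)%N ->
    2 * MV + 1 + g * l%:R <= alpha * h * degree A i)
  (low : forall i : 'I_n, (l <= i)%N ->
    g * (1 + (2 * h' * b) / h) * degree A i <= 1 / 2).

Let h'0 : 0 < h'. Proof. exact: lt_le_trans hh'. Qed.
Let b0 : 0 < b. Proof. exact: lt_le_trans b1. Qed.
Let g0 : 0 < g. Proof. by rewrite !mulr_gt0. Qed.
Let hb0 : 0 < 2 * h' * b. Proof. by rewrite !mulr_gt0. Qed.
Let eps0 : 0 < eps. Proof. by rewrite divr_gt0. Qed.
Let eps1 : eps <= 1.
Proof.
rewrite ler_pdivrMr// mul1r; apply: le_trans hh' _.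
have : h' * 1 <= h' * b by rewrite ler_pM2l.
have := h'0; lra.
Qed.
Let geps : g * eps = alpha * h.
Proof. by rewrite /g /eps; field; rewrite ?gt_eqF. Qed.

Let Qi (i : 'I_n) t : 'M[R]_d := if (i < l)%N then 1%:M else - N i.+1 t.
Let dQi (i : 'I_n) t : 'M[R]_d := if (i < l)%N then 0 else
  - (1%:M - (V i.+1 t)^T *m N i.+1 t - N i.+1 t *m V i.+1 t).

Let Qi_bound i t x y : 0 <= t -> `|dot x (Qi i t *m y)| <= b * (enorm x * enorm y).
Proof.
move=> t0; rewrite /Qi; case: ifP => _; last first.
  by rewrite mulNmx dotNr normrN Nb.
rewrite mul1mx; apply: le_trans (cauchy_schwarz _ _) _.
by rewrite ler_peMl// mulr_ge0 ?enorm_ge0.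
Qed.

Section Pointwise.
Context (t : R) (X : 'cV[R]_(n * d)) (t0 : 0 < t).

Let x i := blk i X.
Let a i := enorm (x i).
Let y (i : 'I_n) := \sum_j laplacian A i j *: (H *m x j).
Let edge i : R := \sum_j (A i j)%:R * (a i * a j).

Let a0 i : 0 <= a i. Proof. exact: enorm_ge0. Qed.
Let edge0 i : 0 <= edge i.
Proof. by apply: sumr_ge0 => j _; rewrite !mulr_ge0. Qed.
Let degree_ge0 i : 0 <= degree A i :> R. Proof. exact: sumr_ge0. Qed.

Let yE i : y i = degree A i *: (H *m x i) - \sum_j (A i j)%:R *: (H *m x j).
Proof.
rewrite /y (eq_bigr (fun j => (i == j)%:R *: (degree A i *: (H *m x j)) -
    (A i j)%:R *: (H *m x j))); last first.
  by move=> j _; rewrite mxE scalerBl scalerA.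
rewrite sumrB (bigD1 i)//= eqxx scale1r big1 ?addr0// => j ji.
by rewrite eq_sym (negbTE ji) scale0r.
Qed.

Let blk_coupled i : blk i (coupled_equations V H alpha A t *m X) =
  V i.+1 t *m x i - alpha *: y i.
Proof.
rewrite /coupled_equations mulmxBl blkB -scalemxAl blkZ blk_tens.
by rewrite (blk_bdiag (fun i => V i.+1 t)).
Qed.

Let dot_yE i z : dot z (y i) =
  degree A i * dot z (H *m x i) - \sum_j (A i j)%:R * dot z (H *m x j).
Proof.
rewrite yE dotDr dotNr dotZr dot_sumr; congr (_ - _).
by apply: eq_bigr => j _; rewrite dotZr.
Qed.

Let dot_y_le i z : (forall u, `|dot z u| <= b * (a i * enorm u)) ->
  `|dot z (y i)| <= b * h' * (degree A i * a i ^+ 2 + edge i).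
Proof.
move=> zb; have zH j : `|dot z (H *m x j)| <= b * h' * (a i * a j).
  apply: le_trans (zb _) _; rewrite -mulrA ler_wpM2l ?(ltW b0)// mulrCA.
  by rewrite ler_wpM2l// Hup.
rewrite dot_yE; apply: le_trans (ler_normB _ _) _; rewrite mulrDr lerD//.
  rewrite normrM ger0_norm ?degree_ge0// mulrCA.
  by apply: ler_wpM2l; [exact: degree_ge0|rewrite expr2; exact: zH].
apply: le_trans (ler_norm_sum _ _ _) _; rewrite /edge mulr_sumr.
by apply: ler_sum => j _; rewrite normrM ger0_norm// mulrCA ler_wpM2l.
Qed.

Let node_term i := dot (blk i (coupled_equations V H alpha A t *m X)) (Qi i t *m x i) +
  dot (x i) (dQi i t *m x i + Qi i t *m blk i (coupled_equations V H alpha A t *m X)).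

Let hub_term (i : 'I_n) : (i < l)%N ->
  node_term i <= (2 * MV - 2 * alpha * h * degree A i) * a i ^+ 2 + g * edge i.
Proof.
move=> il; rewrite /node_term blk_coupled /Qi /dQi il mul0mx add0r !mul1mx.
rewrite dotC dotDr dotNr dotZr dot_yE.
have hV : dot (x i) (V i.+1 t *m x i) <= MV * a i ^+ 2.
  apply: le_trans (ler_norm _) _; apply: le_trans (cauchy_schwarz _ _) _.
  rewrite -/(a i) expr2 mulrCA ler_wpM2l//; apply: le_trans (enorm_mulmx_le _ _) _.
  by apply: ler_wpM2r; [exact: enorm_ge0|exact: VM].
have hH : degree A i * (h * a i ^+ 2) <= degree A i * dot (x i) (H *m x i).
  by rewrite ler_wpM2l// /a enorm_sqr.
have he : \sum_j (A i j)%:R * dot (x i) (H *m x j) <= h' * edge i.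
  rewrite /edge mulr_sumr; apply: ler_sum => j _; rewrite mulrCA ler_wpM2l//.
  apply: le_trans (ler_norm _) _; apply: le_trans (cauchy_schwarz _ _) _.
  by rewrite mulrCA; apply: ler_wpM2l; [exact: enorm_ge0|exact: Hup].
have hg : 2 * (alpha * (h' * edge i)) <= g * edge i.
  have : alpha * (h' * edge i) * 1 <= alpha * (h' * edge i) * b.
    by rewrite ler_wpM2l// !mulr_ge0// ltW.
  rewrite /g; lra.
have := ler_wpM2l (ltW alpha0) hH; have := ler_wpM2l (ltW alpha0) he.
lra.
Qed.

Let low_term (i : 'I_n) : (l <= i)%N ->
  node_term i <= (- 1 + g * degree A i) * a i ^+ 2 + g * edge i.
Proof.
move=> li; rewrite /node_term blk_coupled /Qi /dQi ltnNge li /=.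
set v := V i.+1 t; set P := N i.+1 t; set z := x i; set q := y i.
have -> : dot (v *m z - alpha *: q) (- P *m z) + dot z
    (- (1%:M - v^T *m P - P *m v) *m z + - P *m (v *m z - alpha *: q)) =
    - dot z z + alpha * (dot (P *m z) q + dot (P^T *m z) q).
  have e1 : dot (v *m z) (P *m z) = dot z (v^T *m (P *m z)) by rewrite dot_mull.
  rewrite !(mulNmx, mulmxBl, mulmxDl, mulmxBr, mul1mx) -!scalemxAr -!mulmxA.
  rewrite !(dotDl, dotDr, dotNl, dotNr, dotZl, dotZr) e1.
  rewrite (dot_mull P^T) trmxK.
  by rewrite (dotC (P *m z)); ring.
have bz u : `|dot (P *m z) u| <= b * (a i * enorm u).
  by rewrite dotC (mulrC (a i)); exact: Nb (ltW t0).
have bz' u : `|dot (P^T *m z) u| <= b * (a i * enorm u).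
  by rewrite dot_mull trmxK; exact: Nb (ltW t0).
have h1 := ler_wpM2l (ltW alpha0) (le_trans (ler_norm _) (dot_y_le bz)).
have h2 := ler_wpM2l (ltW alpha0) (le_trans (ler_norm _) (dot_y_le bz')).
have -> : dot z z = a i ^+ 2 by rewrite enorm_sqr.
rewrite /g; lra.
Qed.

Let r (i j : 'I_n) : R :=
  if (i < l)%N == (j < l)%N then 1 else if (i < l)%N then eps else eps^-1.

Lemma sum_node_terms : \sum_i node_term i <= - (1 / 2) * dot X X.
Proof.
have r0 i j : 0 < r i j.
  by rewrite /r; case: ifP => // _; case: ifP => _; rewrite ?invr_gt0.
have r1 i j : r i j * r j i = 1.
  rewrite /r eq_sym; case: eqP => [_|/eqP]; first by rewrite mulr1.
  by case: (i < l)%N; case: (j < l)%N => // _; rewrite ?mulfV ?mulVf// gt_eqF.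
have degE i : degree A i = \sum_j (A i j)%:R :> R by [].
have rhub (i : 'I_n) : (i < l)%N -> \sum_j (A i j)%:R * r i j <= l%:R + eps * degree A i.
  move=> il; rewrite -(sum_ord_lt R ln) degE mulr_sumr -big_split /=.
  apply: ler_sum => j _; rewrite /r il eq_sym eqb_id.
  case: (A i j); case: (j < l)%N; rewrite ?mulr1n ?mulr0n;
    have := eps0; lra.
have rlow (i : 'I_n) : (l <= i)%N -> \sum_j (A i j)%:R * r i j <= degree A i / eps.
  move=> il; rewrite degE mulr_suml; apply: ler_sum => j _; apply: ler_wpM2l => //.
  rewrite /r ltnNge il /=; case: ifP => // _.
  by rewrite -[leLHS]invr1 lef_pV2 ?posrE.
have base i : node_term i <= (if (i < l)%N then 2 * MV - 2 * alpha * h * degree A i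
    else - 1 + g * degree A i) * a i ^+ 2 + g * edge i.
  by case: ltnP => il; [exact: hub_term|exact: low_term].
apply: le_trans (ler_sum _ (fun i _ => base i)) _.
rewrite big_split /= -mulr_sumr.
have := sum_edges_young a AT r0 r1; rewrite -(ler_pM2l g0) => young.
apply: le_trans (lerD (lexx _) young) _.
rewrite mulr_sumr -big_split /= dot_blk mulr_sumr; apply: ler_sum => i _.
rewrite -enorm_sqr -/(x i) -/(a i); 
have key (c s q : R) : 0 <= q -> c + g * s <= - (1 / 2) ->
    c * q + g * (q * s) <= - (1 / 2) * q.
  by move=> q0 /(ler_wpM2r q0); lra.
apply: key; first exact: sqr_ge0.
case: ltnP => il.
  have h1 := hub il; have h2 := ler_wpM2l (ltW g0) (rhub i il).
  move: h2; rewrite mulrDr mulrA geps => h2; lra.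
have h1 := low il; have h2 := ler_wpM2l (ltW g0) (rlow i il).
have e : degree A i / eps = 2 * h' * b / h * degree A i.
  by rewrite /eps invf_div mulrC.
rewrite e in h2; lra.
Qed.

End Pointwise.

(** The form is the Euclidean one on the hubs and minus the Lyapunov function of
    the isolated equation on the other nodes. On the hubs the Laplacian damps
    faster than the isolated equations expand; on the other nodes the coupling
    is a small perturbation; the edges between the two kinds are split unevenly
    by Young's inequality, so that no bound on the degrees of the hubs from above
    is needed. *)
Lemma coupled_lyapunov :
  lyapunov_form (coupled_equations V H alpha A)
    (fun t => bdiag (fun i => Qi i t)) (fun t => bdiag (fun i => dQi i t))
    (pid_mx (l * d)) (1 / 2) b M.
Proof.
have JE i (X : 'cV[R]_(n * d)) :
    blk i (pid_mx (l * d) *m X) = (i < l)%:R *: blk i X.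
  by rewrite -bdiag_pid blk_bdiag mul_scalar_mx.
split=> //.
- move=> t; apply: is_derive_bdiag => i; rewrite /Qi /dQi; case: ifP => _.
    exact: is_derive_cst.
  exact: is_deriveN (dN _ _).
- by move=> t x y t0; apply: enorm_bdiag_le => [|i u v]; [exact: ltW|exact: Qi_bound].
- move=> t X t0; apply: le_trans (sum_node_terms X t0).
  rewrite !dot_blk -big_split /= le_eqVlt; apply/orP; left; apply/eqP.
  by apply: eq_bigr => i _; rewrite blkD !blk_bdiag.
- by rewrite mul_pid_mx minnn; congr pid_mx; apply/minn_idPr; rewrite leq_mul2r ln orbT.
- move=> t X t0 JX; rewrite !dot_blk; apply: ler_sum => i _.
  rewrite blk_bdiag /Qi; case: ifP => il; first by rewrite mul1mx.
  by rewrite -JX JE il scale0r mulmx0 dot0r.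
- move=> X JX; rewrite !dot_blk -sumrN; apply: ler_sum => i _.
  rewrite blk_bdiag /Qi; case: ifP => il; last by rewrite N0// mulNmx mul1mx dotNr.
  have := JE i X; rewrite JX il scale1r => <-.
  have -> : blk i (0 : 'cV[R]_(n * d)) = 0 by apply/colP => k; rewrite !mxE.
  by rewrite mulmx0 dot0r oppr0.
Qed.

End CoupledLyapunov.

(** * The dichotomy on random graphs *)

Lemma coupled_entries (R : realType) (n d : nat) (V : nat -> R -> 'M[R]_d)
    (H : 'M[R]_d) (alpha : R) (A : 'M[bool]_n) : bounded_continuous_family V ->
  (forall i j, continuous (fun t => coupled_equations V H alpha A t i j)) /\
  exists b, forall t i j, `|coupled_equations V H alpha A t i j| <= b.
Proof.
move=> [Vc Vb _].
have BE t i j k l : coupled_equations V H alpha A t (mxtens_index (i, k))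
    (mxtens_index (j, l)) = (i == j)%:R * V i.+1 t k l -
    (alpha *: (laplacian A *t H)) (mxtens_index (i, k)) (mxtens_index (j, l)).
  rewrite /coupled_equations mxE [X in _ + X]mxE; congr (_ - _).
  exact: (bdiagE (fun i => V i.+1 t)).
split.
  move=> p q; case: (mxtens_indexP p) => i k; case: (mxtens_indexP q) => j l.
  under eq_fun do rewrite BE.
  have cV := entry_continuous (Vc i.+1 isT) (i:=k) (j:=l).
  have cM : continuous (fun t : R => (i == j)%:R * V i.+1 t k l).
    by move=> t; apply: (@continuousM R R (fun=> (i == j)%:R));
      [exact: cst_continuous|exact: cV].
  by move=> t; apply: (continuousB (cM t)); exact: cst_continuous.
have ex (i : 'I_n) : exists b, forall t, opnorm (V i.+1 t) <= b by exact: Vb.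
have [b bP] := choice ex.
have [e e0 eP] := mx_entries_bounded (alpha *: (laplacian A *t H)).
exists (\sum_i `|b i| + e) => t p q.
case: (mxtens_indexP p) => i k; case: (mxtens_indexP q) => j l.
rewrite BE; apply: le_trans (ler_normB _ _) _; apply: lerD => //.
apply: (@le_trans _ _ `|V i.+1 t k l|).
  by rewrite normrM ler_piMl// ger0_norm//; case: (i == j).
apply: le_trans (entry_le_opnorm _ _ _) _; apply: le_trans (bP i t) _.
rewrite (bigD1 i)//=; apply: le_trans (ler_norm _) _.
by rewrite lerDl sumr_ge0.
Qed.

Theorem theorem1 (R : realType)
    (theta gamma : R) (ell : nat -> nat) (w : nat -> nat -> R)
    (d : nat) (H : 'M[R]_d) (V : nat -> R -> 'M[R]_d) :
  0 < theta < 1 -> 0 < gamma < 1 ->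
  theta < (3 - Num.sqrt 5) / 2 ->
  gamma > (Num.sqrt 5 - 1) / 2 ->
  strongly_heterogeneous ell theta gamma w ->
  (1 <= d)%N ->
  posdefmx H ->
  bounded_continuous_family V ->
  uniformly_unstable V ->
  exists C c : R, exists N0 : nat,
    [/\ 0 < C, 0 < c, (0 < N0)%N &
     forall (n : nat) (alpha : R), (N0 < n)%N ->
       c < alpha * wmax n (w n) < C * ln (n%:R : R) `^ gamma ->
       graph_prob (w n) (fun A : 'M[bool]_n =>
         exists T : R -> R -> 'M[R]_(n * d),
           evolution_operator (coupled_equations V H alpha A) T /\
           exists P : R -> 'M[R]_(n * d),
             exp_dichotomy T P /\
             forall t : R, 0 <= t -> \rank (P t) = (d * ell n)%N)
       >= 1 - n%:R `^ (- (1 / 2)) - 2 * n%:R `^ (- (1 / 5))].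
Proof.
move=> theta1 gamma1 _ _ sh d1 Hpos Vfam [T [VT [eta0 [K0 [eta0_gt0 K0_gt0 Tdecay]]]]].
have [MV MV0 VM] := bounded_family_opnorm Vfam.
have [h h0 Hlow] := posdef_coercive Hpos.
pose h' := `|opnorm H| + h.
have hh' : h <= h' by rewrite lerDr.
have h'0 : 0 < h' by exact: lt_le_trans hh'.
have Hup x : enorm (H *m x) <= h' * enorm x.
  apply: le_trans (enorm_mulmx_le _ _) _; rewrite ler_wpM2r ?enorm_ge0//.
  by apply: le_trans (ler_norm _) _; rewrite lerDl ltW.
pose b := 1 + K0 ^+ 2 + K0 ^+ 2 / (2 * eta0).
have b1 : 1 <= b.
  rewrite /b -addrA lerDl addr_ge0 ?sqr_ge0//.
  by apply: divr_ge0; [exact: sqr_ge0|apply: mulr_ge0 => //; exact: ltW].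
have b0 : 0 < b by exact: lt_le_trans b1.
have node i : exists N : R -> 'M[R]_d, (1 <= i)%N ->
    [/\ forall t : R, is_derive t 1 N (1%:M - (V i t)^T *m N t - N t *m V i t),
        N 0 = 1%:M &
        forall t x y, 0 <= t -> `|dot x (N t *m y)| <= b * (enorm x * enorm y)].
  have [->|] := posnP i; first by exists (fun=> 0).
  move=> i1; have [Mi ViM] := family_bounded Vfam i1.
  have [N NP] := unstable_node_form (family_continuous Vfam i1) ViM (VT i i1)
    eta0_gt0 K0_gt0 (fun t s => Tdecay i t s i1).
  by exists N.
have [N NP] := choice node.
have [c0 c00 regime] := near_regime theta1 gamma1 sh.
pose C1 := 2 * h' * b.
have C10 : 0 < C1 by rewrite !mulr_gt0.
have hc0 : 0 < h * c0 by rewrite mulr_gt0.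
(* a typical hub has degree at least [c0 * wmax / 4]; half of its damping pays for
   the isolated dynamics and half for the edges between hubs *)
pose c := 8 * (2 * MV + 1) / (h * c0).
have := regime 8 (8 * C1 / (h * c0)) (8 * C1 * (1 + C1 / h)).
case=> N0 _ NN; exists 1, c, N0.+1; split=> //.
  by rewrite divr_gt0// mulr_gt0// ltr_wpDl// mulr_ge0.
move=> n alpha Nn; rewrite mul1r => /andP[clt ltL].
have [elln hubs wge ellsmall lows] := NN n (ltnW (ltnW Nn)).
have n1 : (1 <= n)%N by case: n Nn {clt ltL elln hubs wge ellsmall lows}.
have adm := ensembles_admissible sh n1.
have D0 : 0 < wmax n (w n) by exact: (wmax_gt0 sh n1).
have alpha0 : 0 < alpha.
  rewrite -(pmulr_lgt0 _ D0); apply: lt_trans clt.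
  by rewrite divr_gt0// mulr_gt0// ltr_wpDl// mulr_ge0.
pose bad (i : 'I_n) (A : 'M[bool]_n) : Prop :=
  if (i < ell n)%N then degree A i <= w n i.+1 / 4 else 4 * w n i.+1 <= degree A i.
have nR1 : 1 <= n%:R :> R by rewrite ler1n.
(* all weights are at least [8 * ln n], so the tails [expR (- (w / 4))] are at most
   [n `^ (- 2)] and the union over the [n] nodes costs [n `^ (- 1)] *)
have badp i : graph_prob (w n) (bad i) <= n%:R `^ (- 2).
  apply: (@le_trans _ _ (expR (- (w n i.+1 / 4)))).
    rewrite /bad; case: ltnP => _; first exact: degree_lower_tail adm i.
    exact: degree_upper_tail adm i.
  rewrite /powR gt_eqF ?(lt_le_trans ltr01)// ler_expR.
  by have := wge i.+1 (ltn_ord i); lra.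
have p1 : n%:R `^ (- (1 / 2)) >= n%:R * n%:R `^ (- 2) :> R.
  rewrite -{1}[n%:R]powRr1// -powRD; last by rewrite pnatr_eq0 -lt0n n1 implybT.
  by apply: ler_powR => //; lra.
apply: (@le_trans _ _ (1 - n%:R * n%:R `^ (- 2))).
  by have := powR_ge0 (n%:R : R) (- (1 / 5)); lra.
apply: (graph_prob_union adm badp) => A AT good.
have [Bc [Bb BbP]] := coupled_entries H alpha A Vfam.
have [Phi [Psi pair]] := fundamental_pair_exists Bc BbP.
have hub (i : 'I_n) : (i < ell n)%N ->
    2 * MV + 1 + 2 * alpha * h' * b * (ell n)%:R <= alpha * h * degree A i.
  move=> il; have := good i; rewrite /bad il => /negP; rewrite -ltNge => kappa.
  have wi : c0 * wmax n (w n) <= w n i.+1.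
    rewrite -ler_pdivlMr//; apply: le_trans (ltW hubs) _; rewrite ler_pM2r ?invr_gt0//.
    by apply: (weights_antitone adm) => //; rewrite il ltnW.
  have k1 : c0 * wmax n (w n) / 4 <= degree A i by lra.
  have k2 : alpha * h * (c0 * wmax n (w n) / 4) <= alpha * h * degree A i.
    by apply: ler_wpM2l => //; rewrite ltW// mulr_gt0.
  have k3 : 8 * (2 * MV + 1) <= alpha * wmax n (w n) * (h * c0).
    by rewrite -ler_pdivrMr// ltW.
  have k4 : alpha * (8 * C1 * (ell n)%:R) <= alpha * (wmax n (w n) * (h * c0)).
    by rewrite ler_pM2l// -ler_pdivrMr// mulrAC.
  apply: le_trans k2; rewrite /C1 in k4; lra.
have low (i : 'I_n) : (ell n <= i)%N ->
    2 * alpha * h' * b * (1 + 2 * h' * b / h) * degree A i <= 1 / 2.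
  move=> li; have := good i; rewrite /bad ltnNge li /= => /negP; rewrite -ltNge => kappa.
  have w0 : 0 < w n i.+1 by exact: weight_gt0 adm i.
  have k1 := lows i.+1 (introT andP (conj (leq_ltn_trans li (ltnSn i)) (ltn_ord i))).
  pose q := C1 * (1 + C1 / h); have q0 : 0 < q.
    by rewrite mulr_gt0// addr_gt0// divr_gt0.
  have k2 : alpha * q * degree A i <= alpha * q * (4 * w n i.+1).
    by rewrite ler_pM2l ?ltW// mulr_gt0.
  have k3 : alpha * wmax n (w n) * (8 * q * w n i.+1) <=
      ln n%:R `^ gamma * (8 * q * w n i.+1).
    apply: ler_wpM2r (ltW ltL).
    by apply/ltW/mulr_gt0 => //; apply: mulr_gt0.
  have k4 : wmax n (w n) * (alpha * (8 * q * w n i.+1)) <= wmax n (w n) * 1.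
    rewrite mulr1; apply: le_trans k1; rewrite mulrA (mulrC _ alpha).
    by apply: le_trans k3 _; rewrite /q; lra.
  rewrite ler_pM2l// in k4.
  have -> : 2 * alpha * h' * b * (1 + 2 * h' * b / h) * degree A i =
      alpha * q * degree A i by rewrite /q /C1; ring.
  lra.
exists (fun t s => Phi t *m Psi s); split; first exact: fund_evolution.
have lyap := @coupled_lyapunov R n d (ell n) V H alpha A N MV h h' b
  ((n * d)%:R * Bb) AT (ltnW elln) alpha0 h0 hh' b1 VM Hlow Hup
  (fun i t i1 => let: And3 p _ _ := NP i i1 in p t)
  (fun i i1 => let: And3 _ p _ := NP i i1 in p)
  (fun i t x y i1 => let: And3 _ _ p := NP i i1 in p t x y)
  (fun t x _ => enorm_mulmx_entries x (BbP t)) hub low.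
have [P [dich rankP]] := lyapunov_dichotomy pair lyap.
exists P; split=> // t _.
rewrite rankP rank_pid_mx ?leq_mul2r ?(ltnW elln) ?orbT//; exact: mulnC.
Qed.
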